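(* Let $a\in(-1,1)$ with $a\notin\mathbb{Q}$, and let $H$ be the operator in $L^2((-\frac{\pi}{2},\frac{\pi}{2}))$ defined by $H\psi=-\psi''$ on the domain $\mathsf{D}(H)=\{\psi\in H^2((-\frac{\pi}{2},\frac{\pi}{2})) : \psi(-\frac{\pi}{2})=\psi(\frac{\pi}{2}a)=\psi(\frac{\pi}{2})\}$, with adjoint $H^*$. Define the operator $\Theta$ on $L^2((-\frac{\pi}{2},\frac{\pi}{2}))$ by $$\Theta = \phi_0(\phi_0,\cdot)+P_0+P_-\oplus P_+ ,$$ where $$\phi_0(x)=\begin{cases}(a-1)(x+\frac{\pi}{2}) & \text{if } x\in(-\frac{\pi}{2},\frac{\pi}{2}a),\\ (a+1)(x-\frac{\pi}{2}) & \text{if } x\in(\frac{\pi}{2}a,\frac{\pi}{2}),\end{cases}$$ $$(P_0f)(x)=\frac{f(x)-f(-x)}{2}\quad\text{for } x\in[-\tfrac{\pi}{2},\tfrac{\pi}{2}],$$ and $P_-\oplus P_+$ acts with respect to the decomposition $L^2((-\frac{\pi}{2},\frac{\pi}{2}))\simeq L^2((-\frac{\pi}{2},\frac{\pi}{2}a))\oplus L^2((\frac{\pi}{2}a,\frac{\pi}{2}))$ by $$(P_-f)(x)=\frac{f(x)-f(-x-\frac{\pi}{2}(1-a))}{2}\ \text{ for } x\in[-\tfrac{\pi}{2},\tfrac{\pi}{2}a],\qquad (P_+f)(x)=\frac{f(x)-f(-x+\frac{\pi}{2}(1+a))}{2}\ \text{ for } x\in[\tfrac{\pi}{2}a,\tfrac{\pi}{2}].$$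 Then the operator $H$ satisfies the relation $$H^*\Theta=\Theta H ,$$ and $\Theta$ is a positive, bounded and invertible operator (the inverse is unbounded).
   Context: $L^2((-\frac{\pi}{2},\frac{\pi}{2}))$ is the complex Hilbert space of square-integrable functions; its inner product $(\cdot,\cdot)$ is antilinear in the first argument, and $\phi_0(\phi_0,\cdot)$ is the rank-one operator $f\mapsto(\phi_0,f)\,\phi_0$. $H^2$ denotes the usual Sobolev space, whose elements are identified with their continuous representatives on $[-\frac{\pi}{2},\frac{\pi}{2}]$. $H^*$ is the Hilbert-space adjoint of the densely defined operator $H$. ''Positive'' means $(f,\Theta f)\ge0$ for every $f$; ''invertible'' means that $0$ is not an eigenvalue of $\Theta$ (i.e. $\Theta$ is injective), and the inverse is the operator $\Theta^{-1}$ defined on the range of $\Theta$.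
   Formalization: The relation H*Θ = ΘH is stated on D(H): Θ maps D(H) into D(H* ) and both sides agree there; literal equality including domains is false for every irrational a, since {f : Θf ∈ D(H* )} contains functions outside H². *)

(* Defs.v *)
From mathcomp Require Import all_boot all_order all_algebra.
From mathcomp Require Import complex.
From mathcomp Require Import all_classical all_reals all_analysis.
Import Order.TTheory GRing.Theory Num.Theory.
Import numFieldNormedType.Exports.

Set Implicit Arguments.
Unset Strict Implicit.
Unset Printing Implicit Defensive.

Local Open Scope classical_set_scope.
Local Open Scope complex_scope.
Local Open Scope ring_scope.

Section HilbertSpace.
Context {R : realType}.
Implicit Types f g h u v : R -> R[i].

Definition Omega : set R := `](- (pi / 2)), (pi / 2)[.

Definition Cintegral (D : set R) f : R[i] :=
  (\int[lebesgue_measure]_(x in D) complex.Re (f x)) +i*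
  (\int[lebesgue_measure]_(x in D) complex.Im (f x)).

(* Vectors of L^2(Omega) are represented by functions on R, of which only the
   restriction to Omega, modulo almost everywhere equality, is meaningful. *)
Definition L2 f : Prop :=
  [/\ measurable_fun Omega (fun x => complex.Re (f x)),
      measurable_fun Omega (fun x => complex.Im (f x)) &
      (\int[lebesgue_measure]_(x in Omega)
         (complex.Re (f x) ^+ 2 + complex.Im (f x) ^+ 2)%:E < +oo)%E].

Definition eqL2 f g : Prop := ae_eq lebesgue_measure Omega f g.

Definition inner f g : R[i] := Cintegral Omega (fun x => conjc (f x) * g x).

Definition L2norm f : R := Num.sqrt (complex.Re (inner f f)).

End HilbertSpace.

Section Operators.
Context {R : realType}.

(* A possibly unbounded operator in L^2(Omega) is given by its graph:
   A f g means that f belongs to the domain of A and A f = g. *)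
Definition op := (R -> R[i]) -> (R -> R[i]) -> Prop.

Implicit Types A B : op.

Definition dom A (f : R -> R[i]) : Prop := exists g, A f g.

Definition op_of (T : (R -> R[i]) -> R -> R[i]) : op :=
  fun f g => [/\ L2 f, L2 g & eqL2 g (T f)].

Definition op_comp A B : op := fun f h => exists2 g, B f g & A g h.

Definition op_inv A : op := fun g f => A f g.

(* For a densely defined A this is the graph of an operator. *)
Definition adjoint A : op := fun g h =>
  [/\ L2 g, L2 h & forall f k, A f k -> inner g k = inner h f].

Definition linear_op A : Prop := forall (c : R[i]) f1 f2 g1 g2,
  A f1 g1 -> A f2 g2 -> A (fun x => c * f1 x + f2 x) (fun x => c * g1 x + g2 x).

Definition bounded_op A : Prop :=
  exists C : R, forall f g, A f g -> L2norm g <= C * L2norm f.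

Definition everywhere_defined A : Prop := forall f, L2 f -> dom A f.

Definition positive_op A : Prop := forall f g, A f g -> 0 <= inner f g.

Definition eigenvalue A (z : R[i]) : Prop :=
  exists2 f, ~ eqL2 f (fun=> 0) & A f (fun x => z * f x).

Definition invertible_op A : Prop := ~ eigenvalue A 0.

(* Equality of A and B on D. For A = H^* Theta, B = Theta H and D = dom H this
   is the relation H^* Theta = Theta H in the sense of Dieudonne: Theta maps
   dom H into dom H^*, and both sides agree on dom H. It cannot be read as an
   equality of maximal domains: for irrational a, P0 + Pminus_plus has
   eigenvalues of order n^-2 for infinitely many n, and {f | Theta f \in dom H^*} contains functions
   which are not in H^2. *)
Definition op_eq_on (D : (R -> R[i]) -> Prop) A B : Prop :=
  forall f, D f -> forall g, A f g <-> B f g.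

End Operators.

Section Sobolev.
Context {R : realType}.

(* The test functions are those of class C^oo with compact support in Omega;
   by linearity it is enough to use real-valued ones. *)
Definition test_function (phi : R -> R) : Prop :=
  (forall n x, derivable (phi^`(n))%classic x 1) /\
  exists c d : R, `[c, d] `<=` Omega /\ forall x, x \notin `[c, d] -> phi x = 0.

Definition weak_derivative (u v : R -> R[i]) : Prop :=
  forall phi, test_function phi ->
    Cintegral Omega (fun x => u x * ((phi^`())%classic x)%:C) =
    - Cintegral Omega (fun x => v x * (phi x)%:C).

(* u belongs to H^2(Omega), with second weak derivative w. *)
Definition H2_deriv2 (u w : R -> R[i]) : Prop :=
  exists v, [/\ L2 u, L2 v, L2 w, weak_derivative u v & weak_derivative v w].

Definition continuous_on_closure (u : R -> R[i]) : Prop :=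
  {within `[(- (pi / 2) : R), pi / 2], continuous (fun x => complex.Re (u x))} /\
  {within `[(- (pi / 2) : R), pi / 2], continuous (fun x => complex.Im (u x))}.

End Sobolev.

Section JumpOperator.
Context {R : realType}.
Variable a : R.
Implicit Types f : R -> R[i].

(* u is the continuous representative of psi. *)
Definition Hop : op := fun psi eta =>
  L2 psi /\ L2 eta /\
  exists u w, [/\ eqL2 psi u, continuous_on_closure u, H2_deriv2 u w,
    u (- (pi / 2)) = u (pi / 2 * a) /\ u (pi / 2 * a) = u (pi / 2)
    & eqL2 eta (fun x => - w x)].

Definition phi0 (x : R) : R[i] :=
  (if x < pi / 2 * a then (a - 1) * (x + pi / 2)
   else (a + 1) * (x - pi / 2))%:C.

Definition P0 f (x : R) : R[i] := (f x - f (- x)) / 2.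

Definition Pminus f (x : R) : R[i] := (f x - f (- x - pi / 2 * (1 - a))) / 2.

Definition Pplus f (x : R) : R[i] := (f x - f (- x + pi / 2 * (1 + a))) / 2.

Definition Pminus_plus f (x : R) : R[i] :=
  if x < pi / 2 * a then Pminus f x else Pplus f x.

Definition Theta : op := op_of (fun f x =>
  inner phi0 f * phi0 x + P0 f x + Pminus_plus f x).

End JumpOperator.

(* Main.v *)
(* Write h = pi/2 and c = ha. With f' the composition of f with a reflection, each
   of P0, P_-, P_+ maps f to (f - f')/2, so Theta = phi0 (phi0, .) + P + Q with P
   and Q orthogonal projections, and Theta is bounded, symmetric and positive.

   If u is continuous with weak second derivative w then testing against smooth
   approximations of a tent function gives
   (r - m) u(l) - (r - l) u(m) + (m - l) u(r) = int tent_{l,m,r} w.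
   For l = -h, m = c, r = h the tent is a multiple of phi0, hence phi0 is orthogonal
   to the range of H. For u(l) = u(r) the formula says that u - u(l) is minus the
   integral operator with kernel the Green function of (l, r), applied to w; this
   kernel is symmetric and invariant under the reflection of (l, r), so by Fubini
   (u - u', w1) = (w - w', u1) for any two such pairs (u, w) and (u1, w1). Summing
   over the intervals (-h, h), (-h, c), (c, h) gives (Theta psi, H f) = (Theta H psi, f)
   for psi and f in the domain of H, and this domain is dense.

   If Theta f = 0 then f is invariant under the three reflections, hence under the
   rotation by h + c of the circle of length 2h, which is irrational; so f is
   constant, and f = 0 since (phi0, 1) <> 0. The functions cos (2k(x + h)), where
   k (1 + a) / 2 is close to an integer, are almost in the kernel of Theta, so its
   inverse is unbounded. *)
Require Import Defs.
From mathcomp Require Import all_boot all_order all_algebra.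
From mathcomp Require Import complex.
From mathcomp Require Import all_classical all_reals all_analysis.
From mathcomp Require Import ring lra measurable_realfun.
Import Order.TTheory GRing.Theory Num.Theory.
Import numFieldNormedType.Exports.
Set Implicit Arguments.
Unset Strict Implicit.
Unset Printing Implicit Defensive.
Local Open Scope classical_set_scope.
Local Open Scope ring_scope.

(** * Bounded symmetric operators built from involutions *)

Section SquareIntegrable.
Context d (T : measurableType d) (R : realType).
Context (mu : {measure set T -> \bar R}) (D : set T).
Context (mD : measurable D).
Implicit Types f g : T -> R.

Definition sqint f :=
  measurable_fun D f /\ mu.-integrable D (fun x => (f x ^+ 2)%:E).

Definition ip f g : R := \int[mu]_(x in D) (f x * g x).

Lemma sqint_mul f g : sqint f -> sqint g ->
  mu.-integrable D (fun x => (f x * g x)%:E).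
Proof.
move=> [mf If] [mg Ig].
apply: (@le_integrable _ _ _ mu D mD _ (fun x => (f x ^+ 2)%:E + (g x ^+ 2)%:E)%E).
- by apply/measurable_EFinP; exact: measurable_funM.
- move=> x Dx; rewrite -EFinD /= lee_fin [leRHS]ger0_norm ?addr_ge0 ?sqr_ge0//.
  rewrite ler_norml; nra.
- exact: integrableD.
Qed.

Lemma sqintD f g : sqint f -> sqint g -> sqint (fun x => f x + g x).
Proof.
move=> sf sg; have [mf If] := sf; have [mg Ig] := sg.
split; first exact: measurable_funD.
have -> : (fun x => ((f x + g x) ^+ 2)%:E) =
   (fun x => (f x ^+ 2)%:E + (g x ^+ 2)%:E + 2%:E * (f x * g x)%:E)%E.
  by apply/funext => x; rewrite -EFinM -!EFinD; congr EFin; ring.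
apply: integrableD => //; first exact: integrableD.
by apply: integrableZl => //; exact: sqint_mul.
Qed.

Lemma sqintZ (k : R) f : sqint f -> sqint (fun x => k * f x).
Proof.
move=> [mf If]; split; first by apply: measurable_funM.
have -> : (fun x => ((k * f x) ^+ 2)%:E) = (fun x => (k ^+ 2)%:E * (f x ^+ 2)%:E)%E.
  by apply/funext => x; rewrite -EFinM; congr EFin; ring.
exact: integrableZl.
Qed.

Lemma sqintN f : sqint f -> sqint (fun x => - f x).
Proof.
move=> sf; rewrite (_ : (fun x => - f x) = fun x => (- 1) * f x).
  exact: sqintZ.
by apply/funext => x; rewrite mulN1r.
Qed.

Lemma sqintB f g : sqint f -> sqint g -> sqint (fun x => f x - g x).
Proof. by move=> sf sg; apply: sqintD => //; exact: sqintN. Qed.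

Lemma sqint_bounded f (M : R) : (mu D < +oo)%E -> measurable_fun D f ->
  (forall x, D x -> `|f x| <= M) -> sqint f.
Proof.
move=> Dfin mf fM; split=> //.
apply: (@le_integrable _ _ _ mu D mD _ (fun x => (M ^+ 2)%:E)).
- by apply/measurable_EFinP; exact: measurable_funX.
- move=> x /fM Mx /=; rewrite lee_fin normrX [leRHS]ger0_norm ?sqr_ge0//.
  by rewrite lerXn2r// ?nnegrE// (le_trans _ Mx).
- apply: (measurable_bounded_integrable mD Dfin); first exact: measurable_cst.
  exact: bounded_cst.
Qed.

Lemma ipC f g : ip f g = ip g f.
Proof. by apply: eq_Rintegral => x _; rewrite mulrC. Qed.

Lemma ipDl f1 f2 g : sqint f1 -> sqint f2 -> sqint g ->
  ip (fun x => f1 x + f2 x) g = ip f1 g + ip f2 g.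
Proof.
move=> s1 s2 sg; rewrite /ip -RintegralD//; try exact: sqint_mul.
by apply: eq_Rintegral => x _; rewrite mulrDl.
Qed.

Lemma ipZl k f g : sqint f -> sqint g -> ip (fun x => k * f x) g = k * ip f g.
Proof.
move=> sf sg; rewrite /ip -RintegralZl//; last exact: sqint_mul.
by apply: eq_Rintegral => x _; rewrite mulrA.
Qed.

Lemma ipNl f g : sqint f -> sqint g -> ip (fun x => - f x) g = - ip f g.
Proof.
move=> sf sg; rewrite -mulN1r -ipZl//.
by apply: eq_Rintegral => x _; rewrite mulN1r.
Qed.

Lemma ipBl f1 f2 g : sqint f1 -> sqint f2 -> sqint g ->
  ip (fun x => f1 x - f2 x) g = ip f1 g - ip f2 g.
Proof. by move=> s1 s2 sg; rewrite ipDl ?ipNl//; exact: sqintN. Qed.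

Lemma ip_ge0 f : 0 <= ip f f.
Proof. by apply: Rintegral_ge0 => x _; rewrite -expr2 sqr_ge0. Qed.

Lemma ip_sub_ge0 f g : sqint f -> sqint g -> 0 <= ip f f - 2 * ip f g + ip g g.
Proof.
move=> sf sg; apply: le_trans (ip_ge0 (fun x => f x - g x)) _.
rewrite ipBl//; last exact: sqintB.
by rewrite (ipC f) (ipC g) !ipBl// (ipC g f); lra.
Qed.

Lemma ip_eq0 f : sqint f -> ip f f = 0 -> ae_eq mu D f (fun=> 0).
Proof.
move=> [mf If] f0.
have : (\int[mu]_(x in D) (f x ^+ 2)%:E = 0)%E.
  rewrite -[LHS]fineK; last exact: integrable_fin_num.
  transitivity (ip f f)%:E; last by rewrite f0.
  by rewrite /ip /Rintegral; under [in RHS]eq_integral do rewrite -expr2.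
move=> I0; have mf2 : measurable_fun D (fun x => (f x ^+ 2)%:E).
  by apply/measurable_EFinP; exact: measurable_funX.
have /(ae_eq_integral_abs mu mD mf2) :
    (\int[mu]_(x in D) `|(f x ^+ 2)%:E| = 0)%E.
  by rewrite -[RHS]I0; apply: eq_integral => x _; rewrite gee0_abs// lee_fin sqr_ge0.
apply: filterS => x fx0 Dx; move/(_ Dx)/eqP : fx0.
by rewrite eqe sqrf_eq0 => /eqP.
Qed.

Lemma ae_eq_ipl f1 f2 g : measurable_fun D f1 -> measurable_fun D f2 ->
  measurable_fun D g -> ae_eq mu D f1 f2 -> ip f1 g = ip f2 g.
Proof.
move=> m1 m2 mg f12; rewrite /ip /Rintegral; congr fine.
apply: ae_eq_integral => //;
  try by apply/measurable_EFinP; exact: measurable_funM.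
by apply: filterS f12 => x f12 Dx /=; rewrite f12.
Qed.

Lemma ip_CauchySchwarz f g : sqint f -> sqint g ->
  ip f g ^+ 2 <= ip f f * ip g g.
Proof.
move=> sf sg.
have quad t : 0 <= ip f f + t * (2 * ip f g) + t ^+ 2 * ip g g.
  have stg := sqintZ t sg.
  apply: le_trans (ip_ge0 (fun x => f x + t * g x)) _.
  rewrite ipDl//; last exact: sqintD.
  rewrite ipZl//; last exact: sqintD.
  rewrite (ipC f) (ipC g) !ipDl// !ipZl// (ipC g f).
  by lra.
have [g0|g0] := eqVneq (ip g g) 0.
  have [->|fg0] := eqVneq (ip f g) 0; first by rewrite g0 mulr0 expr0n.
  have := quad (- (ip f f + 1) / (2 * ip f g)).
  rewrite g0 mulr0 addr0 divfK ?mulf_neq0//; lra.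
have gp : 0 < ip g g by rewrite lt_neqAle eq_sym g0 ip_ge0.
have := quad (- ip f g / ip g g).
have -> : ip f f + - ip f g / ip g g * (2 * ip f g) +
   (- ip f g / ip g g) ^+ 2 * ip g g = (ip f f * ip g g - ip f g ^+ 2) / ip g g.
  by field.
by rewrite pmulr_lge0 ?invr_gt0// subr_ge0.
Qed.

Section Involution.
Context (s : T -> T).

(* [s] need not map [D] into itself: [flip2] sends the jump point to an endpoint. *)
Record measure_involution : Prop := MeasureInvolution {
  invol_measurable : forall f, measurable_fun D f -> measurable_fun D (f \o s) ;
  invol_integral : forall f, measurable_fun D f ->
    (\int[mu]_(x in D) (f (s x))%:E = \int[mu]_(x in D) (f x)%:E)%E ;
  involK : forall x, D x -> s (s x) = x }.

Definition antisym f x := (f x - f (s x)) / 2.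

Context (invs : measure_involution).

Lemma sqint_invol f : sqint f -> sqint (f \o s).
Proof.
move=> [mf If]; split; first exact: invol_measurable.
have mf2 : measurable_fun D (fun x => f x ^+ 2) by exact: measurable_funX.
apply/integrableP; split.
  by apply/measurable_EFinP; exact: (invol_measurable invs mf2).
have := invol_integral invs mf2.
under eq_integral do rewrite -[EFin _]gee0_abs ?lee_fin ?sqr_ge0//=.
move=> ->; under eq_integral do rewrite -[EFin _]gee0_abs ?lee_fin ?sqr_ge0//=.
by case/integrableP : If.
Qed.

Lemma ip_invol f g : measurable_fun D f -> measurable_fun D g ->
  ip (f \o s) g = ip f (g \o s).
Proof.
move=> mf mg.
have := invol_integral invs (measurable_funM mf (invol_measurable invs mg)).
move/(congr1 fine); rewrite /ip /Rintegral => <-; congr fine.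
by apply: eq_integral => x /set_mem Dx /=; rewrite involK.
Qed.

Lemma sqint_antisym f : sqint f -> sqint (antisym f).
Proof.
move=> sf; have := sqintZ (2^-1) (sqintB sf (sqint_invol sf)).
by congr sqint; apply/funext => x; rewrite /antisym mulrC.
Qed.

Lemma antisymE f : antisym f = fun x => 2^-1 * (f x - (f \o s) x).
Proof. by apply/funext => x; rewrite /antisym mulrC. Qed.

Lemma ip_antisym f g : sqint f -> sqint g -> ip (antisym f) g = ip f (antisym g).
Proof.
move=> sf sg; have [mf _] := sf; have [mg _] := sg.
have sfs := sqint_invol sf; have sgs := sqint_invol sg.
have sfB := sqintB sf sfs; have sgB := sqintB sg sgs.
rewrite !antisymE ipZl// ipBl// ip_invol//.
by rewrite [in RHS]ipC ipZl// ipBl// (ipC g) [in RHS](ipC _ f).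
Qed.

Lemma ip_antisymxx f : sqint f -> ip (antisym f) f = ip (antisym f) (antisym f).
Proof.
move=> sf; rewrite -ip_antisym//; last exact: sqint_antisym.
apply: eq_Rintegral => x /set_mem Dx.
by rewrite /antisym involK//; congr (_ * _); field.
Qed.

Lemma ip_antisym_le f : sqint f -> ip (antisym f) (antisym f) <= ip f f.
Proof.
move=> sf; have sa := sqint_antisym sf.
rewrite -subr_ge0; apply: le_trans (ip_ge0 (fun x => f x - antisym f x)) _.
rewrite ipBl//; last exact: sqintB.
rewrite (ipC f) (ipC (antisym f)) !ipBl// (ipC f) ip_antisymxx//; lra.
Qed.

End Involution.

Section Operator.
Context (phi : T -> R) (s t : T -> T).
Context (sphi : sqint phi).
Context (invs : measure_involution s) (invt : measure_involution t).

Definition metric_op f x := ip phi f * phi x + antisym s f x + antisym t f x.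

Let sqa f : sqint f -> sqint (antisym s f). Proof. exact: sqint_antisym. Qed.
Let sqb f : sqint f -> sqint (antisym t f). Proof. exact: sqint_antisym. Qed.
Let sqc f k : sqint f -> sqint (fun x => k * phi x + antisym s f x).
Proof. by move=> sf; apply: sqintD; [exact: sqintZ|exact: sqa]. Qed.

Lemma sqint_metric_op f : sqint f -> sqint (metric_op f).
Proof. by move=> sf; apply: sqintD; [exact: sqc|exact: sqb]. Qed.

Lemma ip_metric_opl f g : sqint f -> sqint g ->
  ip (metric_op f) g =
  ip phi f * ip phi g + ip (antisym s f) g + ip (antisym t f) g.
Proof.
move=> sf sg; have sp := sqintZ (ip phi f) sphi.
have sa := sqa sf; have sb := sqb sf; have sc := sqc (ip phi f) sf.
by rewrite /metric_op !ipDl// ipZl.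
Qed.

Lemma metric_op_sym f g : sqint f -> sqint g ->
  ip (metric_op f) g = ip f (metric_op g).
Proof.
move=> sf sg; rewrite (ipC f) !ip_metric_opl// (mulrC (ip phi g)).
by rewrite (ip_antisym invs)// (ip_antisym invt)// (ipC f) (ipC f).
Qed.

Lemma metric_op_ip f : sqint f ->
  ip (metric_op f) f = ip phi f ^+ 2 + ip (antisym s f) (antisym s f) +
    ip (antisym t f) (antisym t f).
Proof.
move=> sf; rewrite ip_metric_opl//.
by rewrite (ip_antisymxx invs)// (ip_antisymxx invt)// -expr2.
Qed.

Lemma metric_op_ge0 f : sqint f -> 0 <= ip (metric_op f) f.
Proof. by move=> sf; rewrite metric_op_ip// !addr_ge0 ?sqr_ge0 ?ip_ge0. Qed.

Lemma ip_sum3_le f g h : sqint f -> sqint g -> sqint h ->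
  ip (fun x => f x + g x + h x) (fun x => f x + g x + h x) <=
  3 * (ip f f + ip g g + ip h h).
Proof.
move=> sf sg sh; have sfg := sqintD sf sg; have sfgh := sqintD sfg sh.
rewrite !ipDl// (ipC f) (ipC g) (ipC h) !ipDl//.
rewrite (ipC g f) (ipC h f) (ipC h g).
have := ip_sub_ge0 sf sg; have := ip_sub_ge0 sf sh; have := ip_sub_ge0 sg sh.
lra.
Qed.

Lemma metric_op_norm_le_parts f : sqint f ->
  ip (metric_op f) (metric_op f) <=
  3 * (ip phi f ^+ 2 * ip phi phi + ip (antisym s f) (antisym s f) +
       ip (antisym t f) (antisym t f)).
Proof.
move=> sf; have sp := sqintZ (ip phi f) sphi.
apply: le_trans (ip_sum3_le sp (sqa sf) (sqb sf)) _.
by rewrite ipZl// (ipC phi (fun x => _ * _)) ipZl// mulrA -expr2.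
Qed.

Lemma metric_op_norm_le f : sqint f ->
  ip (metric_op f) (metric_op f) <= 3 * (ip phi phi ^+ 2 + 2) * ip f f.
Proof.
move=> sf; apply: le_trans (metric_op_norm_le_parts sf) _.
have := ip_antisym_le invs sf; have := ip_antisym_le invt sf.
have := ler_wpM2r (ip_ge0 phi) (ip_CauchySchwarz sphi sf); nra.
Qed.

Lemma metric_op_eq0 f : sqint f -> ae_eq mu D (metric_op f) (fun=> 0) ->
  [/\ ip phi f = 0, ae_eq mu D (antisym s f) (fun=> 0) &
   ae_eq mu D (antisym t f) (fun=> 0)].
Proof.
move=> sf Tf0; have [mf _] := sf; have [mT _] := sqint_metric_op sf.
have : ip (metric_op f) f = 0.
  have m0 : measurable_fun D (fun=> 0 : R) by exact: measurable_cst.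
  rewrite (ae_eq_ipl mT m0 mf Tf0).
  by rewrite /ip; under eq_Rintegral do rewrite mul0r; rewrite Rintegral_cst// mul0r.
rewrite metric_op_ip//.
have p0 := sqr_ge0 (ip phi f).
have a0 := ip_ge0 (antisym s f); have b0 := ip_ge0 (antisym t f).
move=> sum0; split.
- by apply/eqP; rewrite -sqrf_eq0; apply/eqP; lra.
- by apply: ip_eq0; [exact: sqa|lra].
- by apply: ip_eq0; [exact: sqb|lra].
Qed.

End Operator.

End SquareIntegrable.

(** * Reflections and Lebesgue measure *)

Section Reflection.
Context {R : realType}.
Notation mu := (@lebesgue_measure R).

Lemma measurable_reflection (b : R) : measurable_fun setT (fun x : R => b - x).
Proof. by apply: measurable_funB. Qed.

Lemma lebesgue_measure_reflection (b : R) (X : set (measurableTypeR R)) :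
  measurable X -> mu ((fun x => b - x) @^-1` X) = mu X.
Proof.
move=> mX.
rewrite [RHS](@lebesgue_measure_unique R (pushforward mu (fun x : measurableTypeR R => b -
  x : measurableTypeR R))) //.
  exact: measurable_reflection.
move=> _ _ [[u v] _ <-] /=; rewrite /pushforward.
have -> : (fun x => b - x) @^-1` [set` `]u, v]] = [set` `[b - v, b - u[].
  apply/seteqP; split => x /=; rewrite !in_itv/= => /andP[]; lra.
rewrite !lebesgue_measure_itv/= !lte_fin ltrD2l ltrN2; case: ifP => // _.
by rewrite -!EFinB; congr EFin; ring.
Qed.

Lemma preimage_reflection (b u v : R) :
  (fun x => b - x) @^-1` `]u, v[%classic = `](b - v), (b - u)[%classic.
Proof. by apply/seteqP; split => x; rewrite /= !in_itv/= => /andP[]; lra. Qed.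

Lemma ge0_integral_reflection (b u v : R) (f : R -> \bar R) :
  measurable_fun `]u, v[ f -> (forall x, `]u, v[%classic x -> (0 <= f x)%E) ->
  (\int[mu]_(x in `](b - v)%R, (b - u)%R[) f (b - x)%R = \int[mu]_(x in `]u, v[) f x)%E.
Proof.
move=> mf f0; have mr := measurable_reflection b.
rewrite -[X in (\int[mu]_(x in X) f (b - x)%R)%E](preimage_reflection b u v).
rewrite -(@ge0_integral_pushforward _ _ _ _ _ (fun x : measurableTypeR R => (b - x)%R :
  measurableTypeR R) _ mu _ f)//;
  last by move=> x; rewrite inE; exact: f0.
apply: eq_measure_integral => //= A mA Alr.
exact: lebesgue_measure_reflection.
Qed.

Lemma measurable_fun_reflection d (V : measurableType d) (b u v : R) (f : R -> V) :
  measurable_fun `]u, v[ f -> measurable_fun `](b - v), (b - u)[ (fun x => f (b - x)).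
Proof.
move=> mf; apply: (@measurable_comp _ _ _ _ _ _ `]u, v[) => //.
- by move=> _ [x + <-]; rewrite /= !in_itv/= => /andP[]; lra.
- exact: measurable_funTS (measurable_reflection _).
Qed.

Lemma integral_reflection (b u v : R) (f : R -> R) : measurable_fun `]u, v[ f ->
  (\int[mu]_(x in `](b - v)%R, (b - u)%R[) (f (b - x)%R)%:E = \int[mu]_(x in `]u, v[) (f
    x)%:E)%E.
Proof.
move=> /measurable_EFinP mf.
rewrite [LHS]integralE [RHS]integralE; congr (_ - _)%E.
- rewrite -[RHS](ge0_integral_reflection b)//; last exact: measurable_funepos.
  by apply: eq_integral => x _; rewrite !funeposE.
- rewrite -[RHS](ge0_integral_reflection b)//; last exact: measurable_funeneg.
  by apply: eq_integral => x _; rewrite !funenegE.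
Qed.

Lemma measurable_fun_flip d (V : measurableType d) (l r : R) (f : R -> V) :
  measurable_fun `]l, r[ f -> measurable_fun `]l, r[ (fun x => f (l + r - x)).
Proof.
move=> mf; have := measurable_fun_reflection (b := l + r) mf.
by rewrite addrK (_ : l + r - l = r)//; ring.
Qed.

Lemma integral_flip (l r : R) (f : R -> R) : measurable_fun `]l, r[ f ->
  (\int[mu]_(x in `]l, r[) (f (l + r - x)%R)%:E = \int[mu]_(x in `]l, r[) (f x)%:E)%E.
Proof.
move=> mf; have := integral_reflection (l + r) mf.
by rewrite addrK (_ : l + r - l = r)//; ring.
Qed.

Lemma itv_split (l c r : R) : l < c < r ->
  `]l, r[%classic = `]l, c[ `|` ([set c] `|` `]c, r[).
Proof.
move=> /andP[lc cr]; apply/seteqP; split => x /=; rewrite !in_itv/=.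
- by move=> /andP[lx xr]; have [xc|xc|->] := ltgtP x c; [left|right;right|right;left];
  rewrite /= ?in_itv/= ?lx ?xr ?xc.
- move=> [/andP[]|[->|/andP[]]]; lra.
Qed.

Lemma measurable_fun_split d (V : measurableType d) (l c r : R) (f : R -> V) : l < c < r ->
  measurable_fun `]l, r[ f <-> measurable_fun `]l, c[ f /\ measurable_fun `]c, r[ f.
Proof.
move=> lcr; rewrite (itv_split lcr).
have m1 : measurable (`]l, c[%classic : set R) by [].
have m2 : measurable (`]c, r[%classic : set R) by [].
have m3 : measurable ([set c] : set R) by [].
have m4 : measurable ([set c] `|` `]c, r[ : set R) by exact: measurableU.
split.
- move=> /(measurable_funU _ m1 m4)[f1 f4]; split=> //.
  by case/(measurable_funU _ m3 m2) : f4.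
- move=> [f1 f2]; apply/(measurable_funU _ m1 m4); split=> //.
  by apply/(measurable_funU _ m3 m2); split=> //; exact: measurable_fun_set1.
Qed.

Lemma integral_split (l c r : R) (f : R -> \bar R) : l < c < r ->
  measurable_fun `]l, r[ f ->
  (\int[mu]_(x in `]l, r[) f x =
   \int[mu]_(x in `]l, c[) f x + \int[mu]_(x in `]c, r[) f x)%E.
Proof.
move=> lcr mf; have [m1 m2] := (measurable_fun_split f lcr).1 mf.
move: mf; rewrite (itv_split lcr) => mf.
rewrite integral_setU//.
- congr (_ + _)%E; rewrite setU1itv; first by rewrite -integral_itv_obnd_cbnd.
  by rewrite bnd_simp; case/andP: lcr.
- by apply: measurableU => //; exact: measurable_set1.
- rewrite disj_set2E; apply/eqP/seteqP; split => x //=; rewrite !in_itv/=.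
  by move=> [/andP[_ xc]] [xE|/andP[cx _]]; lra.
Qed.

Definition flip2 (l c r x : R) := if x < c then l + c - x else c + r - x.

Lemma flip2_lt (l c r x : R) : x < c -> flip2 l c r x = l + c - x.
Proof. by rewrite /flip2 => ->. Qed.

Lemma flip2_gt (l c r x : R) : c < x -> flip2 l c r x = c + r - x.
Proof. by rewrite /flip2 => /ltW; rewrite leNgt => /negbTE->. Qed.

Lemma reflection_involution (l r : R) :
  measure_involution mu `]l, r[ (fun x => l + r - x).
Proof.
split=> [f|f|x _].
- exact: measurable_fun_flip.
- exact: integral_flip.
- ring.
Qed.

Lemma flip2_involution (l c r : R) : l < c < r ->
  measure_involution mu `]l, r[ (flip2 l c r).
Proof.
move=> lcr; have [lc cr] := andP lcr.
have E1 (g : R -> R) x : x \in `]l, c[%classic -> g (flip2 l c r x) = g (l + c - x).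
  by rewrite inE/= in_itv/= => /andP[_ xc]; rewrite flip2_lt.
have E2 (g : R -> R) x : x \in `]c, r[%classic -> g (flip2 l c r x) = g (c + r - x).
  by rewrite inE/= in_itv/= => /andP[xc _]; rewrite flip2_gt.
have mflip (f : R -> R) : measurable_fun `]l, r[ f -> measurable_fun `]l, r[ (f \o flip2 l
  c r).
  move=> /(measurable_fun_split f lcr)[m1 m2]; apply/(measurable_fun_split _ lcr); split.
  - by move: (measurable_fun_flip m1); apply: eq_measurable_fun => x xI /=; rewrite (E1 f).
  - by move: (measurable_fun_flip m2); apply: eq_measurable_fun => x xI /=; rewrite (E2 f).
split=> [//|f mf|x /=].
- have [m1 m2] := (measurable_fun_split f lcr).1 mf.
  rewrite (integral_split lcr); last by apply/measurable_EFinP; exact: mflip.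
  rewrite [RHS](integral_split lcr); last exact/measurable_EFinP.
  rewrite -(integral_flip m1) -(integral_flip m2); congr (_ + _)%E.
  + by apply: eq_integral => x xI; rewrite (E1 f).
  + by apply: eq_integral => x xI; rewrite (E2 f).
- rewrite in_itv/= => /andP[lx xr]; rewrite /flip2; have [xc|xc] := ltP x c.
  + by rewrite (_ : l + c - x < c) ?ifT; lra.
  + by rewrite ifF; [lra|apply/negbTE; rewrite -leNgt; lra].
Qed.

End Reflection.

Section RealDerivatives.
Context {R : realType}.
Notation mu := (@lebesgue_measure R).
Implicit Types f g : R -> R.

Lemma is_derive_mul f g (x df dg : R) : is_derive x 1 f df -> is_derive x 1 g dg ->
  is_derive x 1 (fun y => f y * g y) (df * g x + f x * dg).
Proof.
move=> hf hg; apply: is_derive_eq (is_deriveM hf hg) _.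
by rewrite /GRing.scale/=; ring.
Qed.

Lemma is_derive_add f g (x df dg : R) : is_derive x 1 f df -> is_derive x 1 g dg ->
  is_derive x 1 (fun y => f y + g y) (df + dg).
Proof. by move=> hf hg; exact: is_deriveD. Qed.

Lemma is_derive_const (c x : R) : is_derive x 1 (fun=> c : R) 0.
Proof. exact: is_derive_cst. Qed.

Lemma is_derive_var (x : R) : is_derive x 1 (fun y : R => y) 1.
Proof. exact: is_derive_id. Qed.

Lemma is_derive_affine f (k b x df : R) : is_derive (k * x + b) 1 f df ->
  is_derive x 1 (fun y => f (k * y + b)) (k * df).
Proof.
move=> hf; rewrite mulrC; apply: (@is_derive1_comp _ f (fun y => k * y + b)) => //.
have := is_derive_add (is_derive_mul (is_derive_const k x) (is_derive_var x))
  (is_derive_const b x).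
by move/is_derive_eq; apply; ring.
Qed.

Lemma is_derive_inv f (x df : R) : f x != 0 -> is_derive x 1 f df ->
  is_derive x 1 (fun y => (f y)^-1) (- df * ((f x)^-1 * (f x)^-1)).
Proof.
move=> fx0 hf; apply: is_derive_eq (is_deriveV fx0 hf) _.
by rewrite /GRing.scale/=; field.
Qed.

Lemma is_derive_continuous f (x df : R) : is_derive x 1 f df -> {for x, continuous f}.
Proof.
by move=> [hf _]; apply: differentiable_continuous; exact/derivable1_diffP.
Qed.

Lemma is_derive_quadratic f (C : R) : (forall x, `|f x| <= C * x ^+ 2) ->
  is_derive (0 : R) 1 f 0.
Proof.
move=> fC; have f0 : f 0 = 0.
  by apply/eqP; rewrite -normr_le0; apply: le_trans (fC 0) _; rewrite expr0n mulr0.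
have C0 : 0 <= C by have := fC 1; rewrite expr1n mulr1; apply: le_trans.
have cv : h^-1 *: (f (h *: 1 + 0) - f 0) @[h --> 0^'] --> (0 : R).
  apply/cvgr0Pnorm_le => e e0; near=> h.
  have h0 : h != 0 by near: h; exact: nbhs_dnbhs_neq.
  rewrite f0 subr0 addr0 /GRing.scale/= mulr1 normrM normfV.
  rewrite ler_pdivrMl ?normr_gt0//; apply: le_trans (fC h) _.
  rewrite -real_normK ?num_real// expr2 mulrCA ler_wpM2l//.
  have : `|h| <= e / (C + 1).
    near: h; apply: dnbhs0_le; rewrite divr_gt0//; lra.
  rewrite ler_pdivlMr; last lra.
  by have := normr_ge0 h; nra.
by split; [apply/cvg_ex; exists 0; exact: cv | exact/cvg_lim].
Unshelve. all: by end_near. Qed.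

Lemma Rintegral_FTC (F f : R -> R) (a b : R) : a < b ->
  (forall x : R, is_derive x 1 F (f x)) -> continuous f ->
  \int[mu]_(x in `[a, b]) f x = F b - F a.
Proof.
move=> ab dF cf; rewrite /Rintegral (@continuous_FTC2 _ f F a b ab)//.
- exact: continuous_subspaceT.
- split=> [x _||].
  + by case: (dF x).
  + apply: cvg_at_right_filter; exact: is_derive_continuous (dF a).
  + apply: cvg_at_left_filter; exact: is_derive_continuous (dF b).
- by move=> x _; rewrite derive1E; apply/derive_val.
Qed.

End RealDerivatives.

(** * Smooth functions *)

Section Smooth.
Context {R : realType}.

Definition flat (n : nat) (x : R) : R :=
  if 0 < x then x^-1 ^+ n * expR (- x^-1) else 0.

(* A class of functions closed under differentiation, hence of smooth functions,
   which contains functions with compact support. *)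
Inductive elem : (R -> R) -> Prop :=
| elem_flat n : elem (flat n)
| elem_cst c : elem (fun=> c)
| elem_id : elem (fun x => x)
| elemD f g : elem f -> elem g -> elem (fun x => f x + g x)
| elemM f g : elem f -> elem g -> elem (fun x => f x * g x)
| elemV f : elem f -> (forall x, f x != 0) -> elem (fun x => (f x)^-1)
| elem_affine f k b : elem f -> elem (fun x => f (k * x + b)).

Lemma flat_le0 n x : x <= 0 -> flat n x = 0.
Proof. by rewrite /flat leNgt => /negbTE->. Qed.

Lemma flat_gt0 n x : 0 < x -> 0 < flat n x.
Proof. by rewrite /flat => x0; rewrite x0 mulr_gt0 ?expR_gt0// exprn_gt0// invr_gt0. Qed.

Lemma flat_ge0 n x : 0 <= flat n x.
Proof. by have [/(flat_le0 n)->|/(flat_gt0 n)/ltW] := leP x 0. Qed.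

Lemma flat_quadratic n x : `|flat n x| <= (n.+2)`!%:R * x ^+ 2.
Proof.
rewrite ger0_norm ?flat_ge0//; have [x0|x0] := leP x 0.
  by rewrite flat_le0// mulr_ge0// sqr_ge0.
rewrite /flat x0 expRN; have t0 : 0 < x^-1 by rewrite invr_gt0.
have := expR_ge1Dxn n.+1 (ltW t0).
set F := (_`!)%:R; have F0 : 0 < F by rewrite ltr0n fact_gt0.
move=> h; have {h} : x^-1 ^+ n.+2 / F <= expR x^-1 by lra.
rewrite ler_pdivrMr// => h.
rewrite ler_pdivrMr ?expR_gt0//.
have -> : x^-1 ^+ n = x ^+ 2 * x^-1 ^+ n.+2.
  by rewrite (exprS _ n.+1) (exprS _ n) expr2; field; rewrite gt_eqF.
have -> : F * x ^+ 2 * expR x^-1 = x ^+ 2 * (expR x^-1 * F) by ring.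
by rewrite ler_pM2l ?exprn_gt0.
Qed.

Lemma flat_derive (n : nat) (x : R) :
  is_derive x 1 (flat n) (flat n.+2 x + (- n%:R) * flat n.+1 x).
Proof.
have [x0|x0|->] := ltgtP x 0.
- rewrite !flat_le0 ?(ltW x0)// mulr0 addr0.
  apply: (@near_eq_is_derive _ R R (fun=> 0)) => //.
  near=> y; rewrite flat_le0//.
  by near: y; apply: lt_le_nbhsl.
- have nz : x != 0 by rewrite gt_eqF.
  have dinv : is_derive x 1 (fun y : R => y^-1) (- (x^-1 * x^-1)).
    by move/is_derive_eq: (is_derive_inv nz (is_derive_var x)); apply; ring.
  apply: (@near_eq_is_derive _ R R (fun y => y^-1 ^+ n * expR (- y^-1))).
    near=> y; rewrite /flat ifT//.
    by near: y; exact: lt_nbhsr.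
  have dexp : is_derive x 1 (fun y => expR (- y^-1)) (expR (- x^-1) * - (- (x^-1 * x^-1))).
    exact: (@is_derive1_comp _ expR (fun y => - y^-1)).
  have := is_deriveX n dinv; rewrite exprfctE => dpow.
  move/is_derive_eq: (is_derive_mul dpow dexp); apply.
  rewrite /flat x0 /GRing.scale/=.
  case: n {dpow} => [|n]; first by rewrite !expr0 /= !mul0r; ring.
  by rewrite /= !exprS; ring.
- rewrite !flat_le0// mulr0 addr0.
  exact: is_derive_quadratic (flat_quadratic n).
Unshelve. all: by end_near. Qed.

Lemma elem_derive f : elem f -> exists2 f', elem f' & forall x : R, is_derive x 1 f (f' x).
Proof.
elim=> {f} [n|c||f g ef [f' ef' df] eg [g' eg' dg]|f g ef [f' ef' df] eg [g' eg' dg]|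
    f ef [f' ef' df] f0|f k b ef [f' ef' df]].
- exists (fun x => flat n.+2 x + (- n%:R) * flat n.+1 x); last exact: flat_derive.
  apply: elemD; first exact: elem_flat.
  by apply: elemM; [exact: elem_cst|exact: elem_flat].
- by exists (fun=> 0); [exact: elem_cst|move=> x; exact: is_derive_const].
- by exists (fun=> 1); [exact: elem_cst|move=> x; exact: is_derive_var].
- exists (fun x => f' x + g' x); first exact: elemD.
  by move=> x; exact: is_derive_add.
- exists (fun x => f' x * g x + f x * g' x); last by move=> x; exact: is_derive_mul.
  by apply: elemD; exact: elemM.
- exists (fun x => (-1) * f' x * ((f x)^-1 * (f x)^-1)); last first.
    by move=> x; rewrite mulN1r; exact: is_derive_inv.
  apply: elemM; first by apply: elemM => //; exact: elem_cst.
  by apply: elemM; exact: elemV.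
- exists (fun x => k * f' (k * x + b)); last by move=> x; exact: is_derive_affine.
  by apply: elemM; [exact: elem_cst|exact: elem_affine].
Qed.

Lemma elem_derive1 f : elem f -> elem f^`()%classic /\
  forall x : R, is_derive x 1 f (f^`()%classic x).
Proof.
move=> /elem_derive[f' ef' df].
have -> : f^`()%classic = f'.
  by apply/funext => x; rewrite derive1E; apply/derive_val.
by [].
Qed.

Lemma elem_derivable n f : elem f -> forall x, derivable (f^`(n))%classic x 1.
Proof.
elim: n f => [|n IH] f ef x.
  by rewrite derive1n0; case: ((elem_derive1 ef).2 x).
by rewrite derive1Sn; apply: IH; exact: (elem_derive1 ef).1.
Qed.

Lemma elem_continuous f : elem f -> continuous f.
Proof. by move=> ef x; exact: is_derive_continuous ((elem_derive1 ef).2 x). Qed.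

Definition smooth_step (x : R) : R := flat 0 x / (flat 0 x + flat 0 (-1 * x + 1)).

Lemma step_denominator_gt0 x : 0 < flat 0 x + flat 0 (-1 * x + 1).
Proof.
have [x0|x0] := ltP 0 x; first by rewrite ltr_wpDr ?flat_ge0// flat_gt0.
by rewrite ltr_wpDl ?flat_ge0// flat_gt0//; lra.
Qed.

Lemma elem_step : elem smooth_step.
Proof.
apply: elemM; first exact: elem_flat.
apply: elemV => [|x]; last by rewrite gt_eqF// step_denominator_gt0.
by apply: elemD; [exact: elem_flat|apply: elem_affine; exact: elem_flat].
Qed.

Lemma step_le0 x : x <= 0 -> smooth_step x = 0.
Proof. by move=> x0; rewrite /smooth_step flat_le0// mul0r. Qed.

Lemma step_ge1 x : 1 <= x -> smooth_step x = 1.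
Proof.
move=> x1; rewrite /smooth_step (@flat_le0 _ (-1 * x + 1)); last lra.
by rewrite addr0 divff// gt_eqF// flat_gt0//; lra.
Qed.

Lemma step_ge0 x : 0 <= smooth_step x.
Proof. by rewrite divr_ge0 ?flat_ge0// ltW// step_denominator_gt0. Qed.

Lemma step_le1 x : smooth_step x <= 1.
Proof.
by rewrite ler_pdivrMr ?step_denominator_gt0// mul1r lerDl flat_ge0.
Qed.

Definition ramp (x : R) : R := x * smooth_step x.

Lemma elem_ramp : elem ramp.
Proof. by apply: elemM; [exact: elem_id|exact: elem_step]. Qed.

Lemma ramp_le0 x : x <= 0 -> ramp x = 0.
Proof. by move=> x0; rewrite /ramp step_le0// mulr0. Qed.

Lemma ramp_ge1 x : 1 <= x -> ramp x = x.
Proof. by move=> x0; rewrite /ramp step_ge1// mulr1. Qed.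

Lemma ramp_close x : `|ramp x - Num.max x 0| <= 1.
Proof.
have [x0|x0] := leP x 0; first by rewrite ramp_le0// subr0 normr0.
have [x1|x1] := leP 1 x; first by rewrite ramp_ge1// subrr normr0.
rewrite /ramp; have := step_ge0 x; have := step_le1 x.
by rewrite ler_norml; nra.
Qed.

Lemma near_eq_derive1 (f g : R -> R) (x : R) : (\near x, f x = g x) ->
  f^`()%classic x = g^`()%classic x.
Proof. by move=> fg; rewrite !derive1E; exact: near_eq_derive. Qed.

Lemma ramp'_lt0 x : x < 0 -> ramp^`()%classic x = 0.
Proof.
move=> x0; rewrite (@near_eq_derive1 _ (fun=> 0)); first by rewrite derive1_cst.
by near=> y; rewrite ramp_le0//; near: y; exact: lt_le_nbhsl.
Unshelve. all: by end_near. Qed.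

Lemma ramp'_gt1 x : 1 < x -> ramp^`()%classic x = 1.
Proof.
move=> x0; rewrite (@near_eq_derive1 _ id); first by rewrite derive1_id.
by near=> y; rewrite ramp_ge1//; near: y; exact: lt_le_nbhsr.
Unshelve. all: by end_near. Qed.

Lemma ramp''_out x : x < 0 \/ 1 < x -> (ramp^`())^`()%classic x = 0.
Proof.
move=> [x0|x1].
- rewrite (@near_eq_derive1 _ (fun=> 0)); first by rewrite derive1_cst.
  by near=> y; rewrite ramp'_lt0//; near: y; exact: lt_nbhsl.
- rewrite (@near_eq_derive1 _ (fun=> 1)); first by rewrite derive1_cst.
  by near=> y; rewrite ramp'_gt1//; near: y; exact: lt_nbhsr.
Unshelve. all: by end_near. Qed.

End Smooth.

(** * The three-point formula *)

Section Mollifier.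
Context {R : realType}.
Notation mu := (@lebesgue_measure R).
Notation h := (@pi R / 2).
Notation Om := (@Omega R).

Lemma pihalf_gt0 : 0 < h. Proof. by rewrite divr_gt0// pi_gt0. Qed.

Lemma derive1_funE (f f' : R -> R) : (forall x : R, is_derive x 1 f (f' x)) ->
  f^`()%classic = f'.
Proof. by move=> df; apply/funext => x; rewrite derive1E; apply/derive_val. Qed.

Lemma elem_test_function (f : R -> R) (c d : R) : elem f ->
  - h < c -> d < h -> (forall x, x \notin `[c, d] -> f x = 0) -> test_function f.
Proof.
move=> ef hc dh f0; split; first by move=> n x; exact: elem_derivable.
exists c, d; split=> //.
by move=> x; rewrite /Omega/= !in_itv/= => /andP[]; lra.
Qed.

Lemma ramp''_bounded : exists2 M : R, 0 < M &
  forall x, `|((@ramp R)^`()^`())%classic x| <= M.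
Proof.
set f := ((@ramp R)^`()^`())%classic.
have cf : continuous f.
  by apply: elem_continuous; apply: (elem_derive1 _).1; exact: (elem_derive1 (elem_ramp)).1.
have cnf : {within `[0, 1], continuous (fun x => `|f x|)}.
  by apply: continuous_subspaceT => x; apply: cvg_norm; exact: cf.
have [c _ fc] := EVT_max ler01 cnf.
exists (`|f c| + 1); first by rewrite ltr_wpDl.
move=> x; have [x0|x0] := ltP x 0; first by rewrite /f ramp''_out ?normr0 ?addr_ge0//; left.
have [x1|x1] := ltP 1 x; first by rewrite /f ramp''_out ?normr0 ?addr_ge0//; right.
by rewrite (le_trans (fc x _)) ?lerDl// in_itv/= x0.
Qed.

Definition scaled (F : R -> R) (e s y : R) := F (e^-1 * y + - (s / e)).

Lemma scaledE F e s y : e != 0 -> scaled F e s y = F ((y - s) / e).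
Proof. by move=> e0; rewrite /scaled; congr F; field. Qed.

Lemma is_derive_scaled F F' (e s x : R) : (forall x : R, is_derive x 1 F (F' x)) ->
  is_derive x 1 (scaled F e s) (e^-1 * scaled F' e s x).
Proof. by move=> dF; exact: is_derive_affine. Qed.

Lemma scaled_continuous F (e s : R) : elem F -> continuous (scaled F e s).
Proof. by move=> eF; apply: elem_continuous; exact: elem_affine. Qed.

Lemma Rintegral_subset_support (J D : set R) (f : R -> R) : J `<=` D ->
  (forall x, D x -> ~ J x -> f x = 0) ->
  \int[mu]_(x in D) f x = \int[mu]_(x in J) f x.
Proof.
move=> JD f0; rewrite Rintegral_mkcond [RHS]Rintegral_mkcond.
apply: eq_Rintegral => x _; rewrite /patch; case: ifPn => [/set_mem Dx|]; case: ifPn => //.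
- by move/negP; rewrite inE; exact: f0.
- by move=> /set_mem /JD Dx; rewrite mem_set.
Qed.

Lemma normr_Rintegral_le (D : set (measurableTypeR R)) (f : R -> R) (C : R) : measurable D ->
  (mu D < +oo)%E -> mu.-integrable D (EFin \o f) -> (forall x, D x -> `|f x| <= C) ->
  `|\int[mu]_(x in D) f x| <= C * fine (mu D).
Proof.
move=> mD Dfin If fC; apply: (le_trans (le_normr_Rintegral mD If)).
rewrite -(Rintegral_cst mu mD); apply: le_Rintegral => //.
- exact: integrable_norm.
- by apply: measurable_bounded_integrable => //; exact: bounded_cst.
Qed.

Lemma within_continuous_dist (a b x0 e : R) (u : R -> R) :
  {within `[a, b], continuous u} -> x0 \in `[a, b] -> 0 < e ->
  exists2 d, 0 < d & forall y, y \in `[a, b] -> `|y - x0| < d -> `|u y - u x0| <= e.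
Proof.
move=> /subspace_continuousP cu x0I e0.
have /cvgrPdist_le/(_ _ e0) := cu x0 x0I.
rewrite near_withinE => /nbhs_ballP[d /= d0 H].
exists d => // y yI yx; rewrite distrC; apply: H => //.
by rewrite /ball/= distrC.
Qed.

Lemma mollify_cvg (u s : R -> R) (x0 : R) : {within `[- h, h], continuous u} ->
  x0 \in `[- h, h] ->
  (\forall e \near 0^'+, [/\ - h < s e - e, s e + 2 * e < h & `|s e - x0| <= 5 * e]) ->
  \int[mu]_(y in Om) (u y * (e^-1 * scaled (ramp^`()^`())%classic e (s e) y))
    @[e --> 0^'+] --> u x0.
Proof.
move=> cu x0I sP; have [M M0 HM] := ramp''_bounded.
apply/cvgrPdist_le => /= eta eta0.
have eta'0 : 0 < eta / (3 * M) by rewrite divr_gt0// mulr_gt0.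
have [d d0 ud] := within_continuous_dist cu x0I eta'0.
near=> e.
have e0 : 0 < e by near: e; exact: nbhs_right_gt.
have [s1 s2 s3] : [/\ - h < s e - e, s e + 2 * e < h & `|s e - x0| <= 5 * e] by near: e.
have ed : 7 * e < d.
  rewrite -ltr_pdivlMl//; near: e; apply: nbhs_right_lt; rewrite mulr_gt0//.
set K := fun y => e^-1 * scaled (ramp^`()^`())%classic e (s e) y.
set J := `[s e - e, s e + 2 * e]%classic.
have elem2 : elem ((@ramp R)^`()^`())%classic.
  by apply: (elem_derive1 _).1; exact: (elem_derive1 elem_ramp).1.
have cK : continuous K.
  move=> y; apply: cvgM; [exact: cvg_cst|exact: scaled_continuous].
have JO : J `<=` Om by move=> y; rewrite /J /Omega/= !in_itv/= => /andP[]; lra.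
have Jh : J `<=` `[- h, h]%classic by move=> y; rewrite /J/= !in_itv/= => /andP[]; lra.
have K0 y : ~ J y -> K y = 0.
  move=> yJ; rewrite /K scaledE ?gt_eqF// ramp''_out ?mulr0//.
  rewrite ltr_pdivrMr// mul0r ltr_pdivlMr// mul1r.
  have [ys|ys] := ltP y (s e); [left; lra|right].
  by rewrite ltNge; apply/negP => yse; apply: yJ; rewrite /J/= in_itv/=; lra.
rewrite (@Rintegral_subset_support J)//; last by move=> y _ /K0; rewrite /K => ->;
  rewrite mulr0.
have Jfin : (mu J < +oo)%E by rewrite lebesgue_measure_itv/=; case: ifP => // _;
  rewrite -EFinB ltry.
have muJ : fine (mu J) = 3 * e.
  rewrite lebesgue_measure_itv/= lte_fin ifT; last lra.
  by rewrite -EFinB/=; ring.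
have cuJ : {within J, continuous u} by exact: continuous_subspaceW Jh cu.
have cKJ : {within J, continuous K} by exact: continuous_subspaceT.
have compJ : compact J by exact: segment_compact.
have Int (f : R -> R) : {within J, continuous f} -> mu.-integrable J (EFin \o f).
  exact: continuous_compact_integrable.
have cuK : {within J, continuous (fun y => u y * K y)}.
  by move=> y; apply: cvgM; [exact: cuJ|exact: cKJ].
have cxK : {within J, continuous (fun y => u x0 * K y)}.
  by move=> y; apply: cvgM; [exact: cvg_cst|exact: cKJ].
have IK : \int[mu]_(y in J) K y = 1.
  have dK (x : R) : is_derive x 1 (scaled ramp^`()%classic e (s e)) (K x).
    apply: is_derive_scaled => y; apply: (elem_derive1 _).2.
    exact: (elem_derive1 elem_ramp).1.
  rewrite (Rintegral_FTC _ dK cK)//; last lra.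
  rewrite !scaledE ?gt_eqF// ramp'_gt1 ?ramp'_lt0 ?subr0//.
    by rewrite ltr_pdivrMr// mul0r; lra.
  by rewrite ltr_pdivlMr// mul1r; lra.
have mJ : measurable (J : set (measurableTypeR R)) by exact: measurable_itv.
have IxK : \int[mu]_(y in J) (u x0 * K y) = u x0.
  by rewrite (RintegralZl (u x0) mJ (Int _ cKJ)) IK mulr1.
rewrite -[X in X - _]IxK -(RintegralB mJ (Int _ cxK) (Int _ cuK)).
apply: le_trans (@normr_Rintegral_le J _ (eta / (3 * M) * (e^-1 * M)) _ Jfin _ _) _ => //.
- have := integrableB mJ (Int _ cxK) (Int _ cuK).
  by apply: eq_integrable => // y _; rewrite /= EFinB.
- move=> y Jy; rewrite -mulrBl normrM ler_pM//.
  + rewrite distrC; apply: ud; first exact: Jh.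
    move: Jy; rewrite /J/= in_itv/= => /andP[y1 y2].
    have : `|y - s e| <= 2 * e by rewrite ler_norml; lra.
    have := ler_normD (y - s e) (s e - x0); rewrite addrA subrK; lra.
  + by rewrite /K normrM gtr0_norm ?invr_gt0// ler_wpM2l ?invr_ge0 ?(ltW e0)//; exact: HM.
- rewrite muJ; have [e1 M1] : e != 0 /\ M != 0 by rewrite !gt_eqF.
  suff -> : eta / (3 * M) * (e^-1 * M) * (3 * e) = eta by [].
  by field; rewrite e1 M1.
Unshelve. all: by end_near. Qed.

End Mollifier.

Section ThreePoint.
Context {R : realType}.
Notation mu := (@lebesgue_measure R).
Notation h := (@pi R / 2).
Notation Om := (@Omega R).

Lemma measurable_OmegaR : measurable (Om : set (measurableTypeR R)).
Proof. exact: measurable_itv. Qed.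

Lemma Omega_fin : (mu Om < +oo)%E.
Proof. by rewrite /Omega lebesgue_measure_itv/=; case: ifP => // _; rewrite -EFinB ltry. Qed.

Lemma cvg_of_dist_le (F : R -> R) (L C : R) :
  (\forall e \near 0^'+, `|F e - L| <= C * e) -> F e @[e --> 0^'+] --> L.
Proof.
move=> FC; apply/cvgrPdist_le => /= eta eta0; near=> e.
have e0 : 0 < e by near: e; exact: nbhs_right_gt.
have FCe : `|F e - L| <= C * e by near: e.
have : e < eta / (`|C| + 1).
  by near: e; apply: nbhs_right_lt; rewrite divr_gt0// ltr_wpDl.
rewrite ltr_pdivlMr ?ltr_wpDl// distrC => eC; apply: le_trans FCe _.
by have := ler_norm C; have := normr_ge0 C; nra.
Unshelve. all: by end_near. Qed.

Lemma continuous_bounded_Omega (f : R -> R) : {within `[- h, h], continuous f} ->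
  exists2 C, 0 <= C & forall x, Om x -> `|f x| <= C.
Proof.
move=> cf; have hh : - h <= h by have := @pihalf_gt0 R; lra.
have cnf : {within `[- h, h], continuous (fun x => `|f x|)}.
  by move=> x; apply: cvg_norm; exact: cf.
have [c _ fc] := EVT_max hh cnf.
exists `|f c| => // x; rewrite /Omega/= in_itv/= => /andP[x1 x2].
by apply: fc; rewrite in_itv/= !ltW.
Qed.

Lemma integrable_mul_bounded (D : set (measurableTypeR R)) (f g : R -> R) (C : R) :
  measurable D -> mu.-integrable D (EFin \o f) -> measurable_fun D g ->
  (forall x, D x -> `|g x| <= C) -> mu.-integrable D (EFin \o (fun x => f x * g x)).
Proof.
move=> mD If mg gC.
apply: (@le_integrable _ _ _ mu D mD _ (fun x => C%:E * (f x)%:E)%E).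
- apply/measurable_EFinP; apply: measurable_funM => //.
  by case/integrableP : If => /measurable_EFinP.
- move=> x Dx /=; rewrite lee_fin !normrM mulrC ler_wpM2r//.
  by apply: le_trans (gC x Dx) _; exact: ler_norm.
- exact: integrableZl.
Qed.

Lemma integrable_bounded_mul (D : set (measurableTypeR R)) (f g : R -> R) (C : R) :
  measurable D -> mu.-integrable D (EFin \o f) -> measurable_fun D g ->
  (forall x, D x -> `|g x| <= C) -> mu.-integrable D (EFin \o (fun x => g x * f x)).
Proof.
move=> mD If mg gC; have := integrable_mul_bounded mD If mg gC.
by congr integrable; apply/funext => x; rewrite /= mulrC.
Qed.

Lemma Rintegral_zero (D : set (measurableTypeR R)) (f : R -> R) : measurable D ->
  (forall x, D x -> f x = 0) -> \int[mu]_(x in D) f x = 0.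
Proof.
move=> mD f0; transitivity (\int[mu]_(x in D) (0 : R)).
  by apply: eq_Rintegral => x /set_mem /f0.
by rewrite (Rintegral_cst mu mD 0) mul0r.
Qed.

Lemma integrable_scale (D : set (measurableTypeR R)) (f : R -> R) (k : R) :
  measurable D -> mu.-integrable D (EFin \o f) ->
  mu.-integrable D (EFin \o (fun x => k * f x)).
Proof.
move=> mD If.
rewrite (_ : EFin \o _ = fun x => (k%:E * (EFin \o f) x)%E); first exact: integrableZl.
by apply/funext => x; rewrite /= EFinM.
Qed.

Lemma integrable_add (D : set (measurableTypeR R)) (f g : R -> R) :
  measurable D -> mu.-integrable D (EFin \o f) -> mu.-integrable D (EFin \o g) ->
  mu.-integrable D (EFin \o (fun x => f x + g x)).
Proof.
move=> mD If Ig; have := integrableD mD If Ig.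
by apply: eq_integrable => // x _; rewrite /= EFinD.
Qed.

Lemma Rintegral_lin3 (D : set (measurableTypeR R)) (f1 f2 f3 : R -> R) (a b c : R) :
  measurable D -> mu.-integrable D (EFin \o f1) -> mu.-integrable D (EFin \o f2) ->
  mu.-integrable D (EFin \o f3) ->
  \int[mu]_(x in D) (a * f1 x + b * f2 x + c * f3 x) =
  a * \int[mu]_(x in D) f1 x + b * \int[mu]_(x in D) f2 x + c * \int[mu]_(x in D) f3 x.
Proof.
move=> mD I1 I2 I3.
have J1 : mu.-integrable D (EFin \o (fun x => a * f1 x)) by exact: integrable_scale.
have J2 : mu.-integrable D (EFin \o (fun x => b * f2 x)) by exact: integrable_scale.
have J3 : mu.-integrable D (EFin \o (fun x => c * f3 x)) by exact: integrable_scale.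
have J12 : mu.-integrable D (EFin \o (fun x => a * f1 x + b * f2 x)).
  exact: integrable_add.
rewrite (RintegralD mD J12 J3) (RintegralD mD J1 J2).
by rewrite (RintegralZl a mD I1) (RintegralZl b mD I2) (RintegralZl c mD I3).
Qed.

Lemma continuous_measurable_Omega (f : R -> R) : continuous f -> measurable_fun Om f.
Proof. by move=> cf; apply: measurable_funTS; exact: continuous_measurable_fun. Qed.

Lemma continuous_integrable_Omega (f : R -> R) : {within `[- h, h], continuous f} ->
  mu.-integrable Om (EFin \o f).
Proof.
move=> cf; apply: (@integrableS _ _ _ mu (`[- h, h]%classic : set (measurableTypeR R))).
- exact: measurable_itv.
- exact: measurable_OmegaR.
- by move=> x; rewrite /Omega/= !in_itv/= => /andP[]; lra.
- by apply: continuous_compact_integrable => //; exact: segment_compact.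
Qed.

(* The second antiderivative of (r - m) delta_l - (r - l) delta_m + (m - l) delta_r
   which has compact support. *)
Definition tent (l m r y : R) :=
  (r - m) * Num.max (y - l) 0 - (r - l) * Num.max (y - m) 0 +
  (m - l) * Num.max (y - r) 0.

Lemma pospart_lip (x y : R) : `|Num.max x 0 - Num.max y 0| <= `|x - y|.
Proof.
have [x0|x0] := leP x 0; have [y0|y0] := leP y 0; rewrite ?subrr ?normr0 ?sub0r ?subr0//.
- by rewrite normrN gtr0_norm// ler_normr; apply/orP; right; lra.
- by rewrite gtr0_norm// ler_normr; apply/orP; left; lra.
Qed.

Lemma scaled_ramp_close (e s l y : R) : 0 < e -> `|s - l| <= 3 * e ->
  `|e * scaled ramp e s y - Num.max (y - l) 0| <= 4 * e.
Proof.
move=> e0 sl; rewrite scaledE ?gt_eqF//.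
have -> : Num.max (y - l) 0 = Num.max (y - s) 0 + (Num.max (y - l) 0 - Num.max (y - s) 0)
  by ring.
have h1 : `|Num.max (y - l) 0 - Num.max (y - s) 0| <= 3 * e.
  by apply: le_trans (pospart_lip _ _) _; rewrite (_ : _ - _ = s - l)//; ring.
have h2 : `|e * ramp ((y - s) / e) - Num.max (y - s) 0| <= e.
  have -> : Num.max (y - s) 0 = e * Num.max ((y - s) / e) 0.
    by rewrite maxr_pMr ?ltW// mulr0; congr Num.max; field; rewrite gt_eqF.
  rewrite -mulrBr normrM gtr0_norm// -[leRHS]mulr1 ler_pM2l//.
  exact: ramp_close.
rewrite opprD addrA; apply: le_trans (ler_normB _ _) _; lra.
Qed.

Section ThreePointLemma.
Context (u w : R -> R) (l m r : R).
Context (hl : - h <= l) (lm : l < m) (mr : m < r) (rh : r <= h).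
Context (cu : {within `[- h, h], continuous u}).
Context (Iw : mu.-integrable Om (EFin \o w)).
Context (weak : forall phi, test_function phi ->
  \int[mu]_(x in Om) (u x * (phi^`()^`())%classic x) = \int[mu]_(x in Om) (w x * phi x)).

(* [phi e] is a smooth version of the tent, supported inside (l, r), and tends to
   it uniformly as [e] tends to 0. *)
Let s (e : R) : R := l + 2 * e.
Let t (e : R) : R := r - 3 * e.
Let phi (e y : R) : R := ((t e - m) * e) * scaled ramp e (s e) y +
   (- (t e - s e) * e) * scaled ramp e m y + ((m - s e) * e) * scaled ramp e (t e) y.
Let kern (e s y : R) : R := e^-1 * scaled ((@ramp R)^`()^`())%classic e s y.

Let elem_phi (e : R) : elem (phi e).
Proof.
have es s' : elem (scaled ramp e s') by apply: elem_affine; exact: elem_ramp.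
by apply: elemD; [apply: elemD|]; apply: elemM; try exact: elem_cst; exact: es.
Qed.

Let elem_ramp1 : elem (@ramp R)^`()%classic.
Proof. exact: (elem_derive1 elem_ramp).1. Qed.

Let elem_ramp2 : elem ((@ramp R)^`()^`())%classic.
Proof. exact: (elem_derive1 elem_ramp1).1. Qed.

Let phi'' (e : R) : 0 < e -> (phi e)^`()^`()%classic = fun y =>
  (t e - m) * kern e (s e) y + - (t e - s e) * kern e m y + (m - s e) * kern e (t e) y.
Proof.
move=> e0.
have d1 s' (x : R) : is_derive x 1 (scaled ramp e s') (e^-1 * scaled (@ramp R)^`()%classic
  e s' x).
  by apply: is_derive_scaled => y; exact: (elem_derive1 elem_ramp).2.
have d2 s' (x : R) : is_derive x 1 (scaled (@ramp R)^`()%classic e s') (kern e s' x).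
  by apply: is_derive_scaled => y; exact: (elem_derive1 elem_ramp1).2.
have dz k f (f' : R -> R) (x : R) : is_derive x 1 f (f' x) ->
    is_derive x 1 (fun y => k * f y) (k * f' x).
  move=> df; have := is_derive_mul (is_derive_const k x) df.
  by rewrite mul0r add0r.
have e1 : e != 0 by rewrite gt_eqF.
have cancel k s' x : k * scaled (@ramp R)^`()%classic e s' x =
    (k * e) * (e^-1 * scaled (@ramp R)^`()%classic e s' x) by field.
have D1 : (phi e)^`()%classic = fun y => (t e - m) * scaled (@ramp R)^`()%classic e (s e) y +
    - (t e - s e) * scaled (@ramp R)^`()%classic e m y +
    (m - s e) * scaled (@ramp R)^`()%classic e (t e) y.
  apply: derive1_funE => x; rewrite (cancel (t e - m)) (cancel (- _)) (cancel (m - s e)).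
  by apply: is_derive_add.
by rewrite D1; apply: derive1_funE => x.
Qed.

Let test_phi (e : R) : 0 < e -> 6 * e < m - l -> 6 * e < r - m -> test_function (phi e).
Proof.
have [Hl Hlm Hmr Hrh] := And4 hl lm mr rh; move=> e0 el er.
apply: (@elem_test_function _ _ (s e) (t e + e)) => //.
- by rewrite /s; lra.
- by rewrite /t; lra.
- move=> x; rewrite in_itv/= negb_and -!ltNge /phi !scaledE ?gt_eqF// => /orP[xs|xt].
  + rewrite !ramp_le0 ?mulr0 ?addr0// ler_pdivrMr// mul0r; move: xs; rewrite /s /t; lra.
  + rewrite !ramp_ge1 ?ler_pdivlMr ?mul1r//; last 3 first.
    * by move: xt; rewrite /s /t; lra.
    * by move: xt; rewrite /s /t; lra.
    * by move: xt; rewrite /s /t; lra.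
    by rewrite /s /t; field; rewrite gt_eqF.
Qed.

Let integrable_ukern (e s' : R) : mu.-integrable Om (EFin \o (fun y => u y * kern e s' y)).
Proof.
apply: continuous_integrable_Omega => y; apply: cvgM; first exact: cu.
apply: (@continuous_subspaceT _ _ _ _ _) => {}y.
by apply: cvgM; [exact: cvg_cst|exact: scaled_continuous].
Qed.

Let phi_close (e y : R) : 0 < e -> 6 * e < m - l -> 6 * e < r - m -> Om y ->
  `|phi e y - tent l m r y| <= 44 * h * e.
Proof.
have [Hl Hlm Hmr Hrh] := And4 hl lm mr rh.
move=> e0 el er; rewrite /Omega/= in_itv/= => /andP[yl yr].
have := @scaled_ramp_close e (s e) l y e0; have := @scaled_ramp_close e m m y e0.
have := @scaled_ramp_close e (t e) r y e0.
rewrite {1}/s {1}/t subrr normr0 => /(_ _)/wrap[|H3].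
  by rewrite (_ : _ - r = - (3 * e)) ?normrN ?ger0_norm//; [lra|ring].
move=> /(_ _)/wrap[|H2]; first lra.
move=> /(_ _)/wrap[|H1]; first by rewrite (_ : _ - l = 2 * e) ?ger0_norm//; [lra|lra|ring].
rewrite /phi /tent.
have pb x : - (2 * h) <= x <= 2 * h -> 0 <= Num.max x 0 <= 2 * h.
  by move=> /andP[x1 x2]; rewrite le_max lexx orbT ge_max x2/=; lra.
have /andP[P0 P1] := pb (y - l) ltac:(lra).
have /andP[Q0 Q1] := pb (y - m) ltac:(lra).
have /andP[T0 T1] := pb (y - r) ltac:(lra).
have pe z : 0 <= z -> z <= 2 * h -> 0 <= e * z /\ e * z <= 2 * h * e.
  by move=> z0 z1; split; [rewrite mulr_ge0// ltW|rewrite mulrC ler_pM2r].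
have [eP0 eP1] := pe _ P0 P1; have [eQ0 eQ1] := pe _ Q0 Q1.
have [eT0 eT1] := pe _ T0 T1.
have bd k z : 0 <= k -> k <= 2 * h -> `|z| <= 4 * e -> `|k * z| <= 8 * h * e.
  move=> k0 k1 z1; rewrite normrM (ger0_norm k0).
  by rewrite (_ : 8 * h * e = 2 * h * (4 * e)); [exact: ler_pM|ring].
have := bd (t e - m) _ ltac:(rewrite /t; lra) ltac:(rewrite /t; lra) H1.
have := bd (t e - s e) _ ltac:(rewrite /t /s; lra) ltac:(rewrite /t /s; lra) H2.
have := bd (m - s e) _ ltac:(rewrite /s; lra) ltac:(rewrite /s; lra) H3.
set P := Num.max (y - l) 0 in P0 P1 eP0 eP1 *; set Q := Num.max (y - m) 0 in Q0 Q1 eQ0 eQ1 *.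
set T := Num.max (y - r) 0 in T0 T1 eT0 eT1 *.
set d1 := _ * (_ - P); set d2 := _ * (_ - Q); set d3 := _ * (_ - T).
rewrite !ler_norml => /andP[d3l d3u] /andP[d2l d2u] /andP[d1l d1u].
have -> : (t e - m) * e * scaled ramp e (s e) y + - (t e - s e) * e * scaled ramp e m y +
    (m - s e) * e * scaled ramp e (t e) y - ((r - m) * P - (r - l) * Q + (m - l) * T) =
    d1 - d2 + d3 - 3 * (e * P) + 5 * (e * Q) - 2 * (e * T).
  by rewrite /d1 /d2 /d3 /s /t; ring.
lra.
Qed.

Lemma three_point :
  (r - m) * u l - (r - l) * u m + (m - l) * u r = \int[mu]_(y in Om) (w y * tent l m r y).
Proof.
have [Hl Hlm Hmr Hrh] := And4 hl lm mr rh.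
have tent_cont : continuous (tent l m r).
  have cmax k : continuous (fun y : R => Num.max (y - k) 0).
    move=> y; apply: (@continuous_max _ _ (fun y => y - k) (fun=> 0)); last exact: cvg_cst.
    by apply: cvgB; [exact: cvg_id|exact: cvg_cst].
  by move=> y; apply: cvgD; [apply: cvgB|]; apply: cvgM; (exact: cvg_cst || exact: cmax).
have bounded_int f : continuous f -> mu.-integrable Om (EFin \o (fun y => w y * f y)).
  move=> cf; have [C C0 fC] := continuous_bounded_Omega (continuous_subspaceT cf).
  exact: (integrable_mul_bounded measurable_OmegaR Iw (continuous_measurable_Omega cf) fC).
have near_small : \forall e \near 0^'+, [/\ 0 < e, 6 * e < m - l & 6 * e < r - m].
  near=> e; split.
  - by near: e; exact: nbhs_right_gt.
  - by rewrite -ltr_pdivlMl//; near: e; apply: nbhs_right_lt; rewrite mulr_gt0// subr_gt0.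
  - by rewrite -ltr_pdivlMl//; near: e; apply: nbhs_right_lt; rewrite mulr_gt0// subr_gt0.
pose B (e : R) : R := \int[mu]_(y in Om) (w y * phi e y).
pose U (e s' : R) : R := \int[mu]_(y in Om) (u y * kern e s' y).
pose A (e : R) : R := (t e - m) * U e (s e) + - (t e - s e) * U e m + (m - s e) * U e (t e).
have mO := measurable_OmegaR.
have AB : \forall e \near 0^'+, B e = A e.
  apply: filterS near_small => e [e0 el er].
  rewrite /B -weak; last exact: test_phi.
  rewrite phi''// /A /U.
  have I1 := integrable_ukern e (s e); have I2 := integrable_ukern e m.
  have I3 := integrable_ukern e (t e).
  rewrite -(Rintegral_lin3 (t e - m) (- (t e - s e)) (m - s e) mO I1 I2 I3).
  by apply: eq_Rintegral => y _; rewrite !mulrDr; congr (_ + _ + _); exact: mulrCA.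
have Bcv : B e @[e --> 0^'+] --> \int[mu]_(y in Om) (w y * tent l m r y).
  pose W := \int[mu]_(y in Om) `|w y|.
  apply: (@cvg_of_dist_le _ _ (44 * h * W)); apply: filterS near_small => e [e0 el er].
  have cphi := elem_continuous (elem_phi e).
  rewrite /B -RintegralB//; [|exact: bounded_int|exact: bounded_int].
  have Id := integrableB mO (bounded_int _ cphi) (bounded_int _ tent_cont).
  apply: (le_trans (le_normr_Rintegral mO Id)).
  rewrite (_ : 44 * h * W * e = (44 * h * e) * W); last by ring.
  rewrite /W -RintegralZl//; last exact: integrable_norm.
  apply: le_Rintegral => //.
  - exact: (integrable_norm Id).
  - by apply: integrable_scale => //; exact: integrable_norm.
  - move=> y Oy; rewrite -mulrBr normrM mulrC ler_wpM2r//; exact: phi_close.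
have moll s' x0 : x0 \in `[- h, h] ->
   (\forall e \near 0^'+, [/\ - h < s' e - e, s' e + 2 * e < h & `|s' e - x0| <= 5 * e]) ->
   U e (s' e) @[e --> 0^'+] --> u x0.
  by move=> x0I sP; exact: mollify_cvg.
have id0 : (e : R) @[e --> 0^'+] --> (0 : R) by apply: cvg_at_right_filter; exact: cvg_id.
have tcv : t e @[e --> 0^'+] --> r.
  rewrite -[X in _ --> X]subr0 -[X in _ - X](mulr0 3).
  by apply: cvgB; [exact: cvg_cst|apply: cvgM => //; exact: cvg_cst].
have scv : s e @[e --> 0^'+] --> l.
  rewrite -[X in _ --> X]addr0 -[X in _ + X](mulr0 2).
  by apply: cvgD; [exact: cvg_cst|apply: cvgM => //; exact: cvg_cst].
have Us : U e (s e) @[e --> 0^'+] --> u l.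
  apply: moll; first by rewrite in_itv/=; lra.
  apply: filterS near_small => e [e0 el er]; rewrite /s; split; try lra.
  by rewrite ler_norml; lra.
have Um : U e m @[e --> 0^'+] --> u m.
  apply: (moll (fun=> m)); first by rewrite in_itv/=; lra.
  apply: filterS near_small => e [e0 el er]; split; try lra.
  by rewrite ler_norml; lra.
have Ut : U e (t e) @[e --> 0^'+] --> u r.
  apply: moll; first by rewrite in_itv/=; lra.
  apply: filterS near_small => e [e0 el er]; rewrite /t; split; try lra.
  by rewrite ler_norml; lra.
have Acv : A e @[e --> 0^'+] --> (r - m) * u l + - (r - l) * u m + (m - l) * u r.
  apply: cvgD; first apply: cvgD.
  - by apply: cvgM => //; apply: cvgB => //; exact: cvg_cst.
  - by apply: cvgM => //; apply: cvgN; exact: cvgB.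
  - by apply: cvgM => //; apply: cvgB => //; exact: cvg_cst.
rewrite -mulNr; apply: (cvg_unique _ Acv); first exact: Rhausdorff.
apply: cvg_trans Bcv; apply: near_eq_cvg.
exact: AB.
Unshelve. all: by end_near. Qed.

End ThreePointLemma.
End ThreePoint.

(** * Green functions *)

Section Green.
Context {R : realType}.
Notation mu := (@lebesgue_measure R).
Notation h := (@pi R / 2).
Notation Om := (@Omega R).
Notation mR := (measurableTypeR R).

Lemma Rintegral_Fubini (F : R -> R -> R) :
  (mu \x mu)%E.-integrable setT (fun z : mR * mR => (F z.1 z.2)%:E) ->
  (forall x, mu.-integrable setT (fun y => (F x y)%:E)) ->
  (forall y, mu.-integrable setT (fun x => (F x y)%:E)) ->
  \int[mu]_x (\int[mu]_y F x y) = \int[mu]_y (\int[mu]_x F x y).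
Proof.
move=> IF I1 I2; rewrite {1 3}/Rintegral; congr fine.
transitivity (\int[mu]_x (\int[mu]_y (F x y)%:E))%E.
  apply: eq_integral => x _; rewrite fineK//.
  exact: (integrable_fin_num measurableT (I1 x)).
rewrite (Fubini IF); apply: eq_integral => y _; rewrite fineK//.
exact: (integrable_fin_num measurableT (I2 y)).
Qed.

Lemma kernel_Fubini (J : set mR) (K : R -> R -> R) (C : R) (w w' : R -> R) :
  measurable J ->
  measurable_fun setT (fun z : mR * mR => K z.1 z.2) ->
  (forall x y, J x -> J y -> `|K x y| <= C) ->
  mu.-integrable J (EFin \o w) -> mu.-integrable J (EFin \o w') ->
  \int[mu]_(x in J) ((\int[mu]_(y in J) (K x y * w y)) * w' x) =
  \int[mu]_(y in J) (w y * \int[mu]_(x in J) (K x y * w' x)).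
Proof.
move=> mJ mK KC Iw Iw'.
pose W := w \_ J; pose W' := w' \_ J.
have IW : mu.-integrable setT (EFin \o W).
  by move: Iw; rewrite integrable_mkcond// restrict_EFin.
have IW' : mu.-integrable setT (EFin \o W').
  by move: Iw'; rewrite integrable_mkcond// restrict_EFin.
have mW : measurable_fun setT W by case/integrableP : IW => /measurable_EFinP.
have mW' : measurable_fun setT W' by case/integrableP : IW' => /measurable_EFinP.
pose F x y := K x y * (W y * W' x).
have Wout x : ~ J x -> W x = 0 by move=> Jx; rewrite /W patchE memNset.
have Wout' x : ~ J x -> W' x = 0 by move=> Jx; rewrite /W' patchE memNset.
have Win x : J x -> W x = w x by move=> Jx; rewrite /W patchE mem_set.
have Win' x : J x -> W' x = w' x by move=> Jx; rewrite /W' patchE mem_set.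
have FC x y : `|F x y| <= `|C| * (`|W y| * `|W' x|).
  rewrite /F !normrM; have [Jx|/Wout' ->] := pselect (J x); last by rewrite normr0 !mulr0.
  have [Jy|/Wout ->] := pselect (J y); last by rewrite normr0 mul0r !mulr0.
  by rewrite ler_wpM2r ?mulr_ge0// (le_trans (KC _ _ Jx Jy))// ler_norm.
have mF : measurable_fun setT (fun z : mR * mR => F z.1 z.2).
  apply: measurable_funM => //; apply: measurable_funM.
  - exact: (measurableT_comp mW (@measurable_snd _ _ mR mR)).
  - exact: (measurableT_comp mW' (@measurable_fst _ _ mR mR)).
have mF1 x : measurable_fun setT (F x).
  exact: (measurableT_comp mF (measurable_pair1 x)).
have mF2 y : measurable_fun setT (F^~ y).
  exact: (measurableT_comp mF (measurable_pair2 y)).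
have nm (f : mR -> R) : measurable_fun setT f -> measurable_fun setT (fun x => `|f x|).
  by move=> mf; exact: measurableT_comp.
have IaW := integrable_norm IW; have IaW' := integrable_norm IW'.
have I1 x : mu.-integrable setT (fun y => (F x y)%:E).
  apply: (@le_integrable _ _ _ mu setT measurableT _ (EFin \o (fun y => (`|C| * `|W' x|) *
    `|W y|))).
  - by apply/measurable_EFinP; exact: mF1.
  - move=> y _ /=; rewrite lee_fin; apply: le_trans (FC x y) _.
    by rewrite (mulrC `|W y|) mulrA; exact: ler_norm.
  - by apply: integrable_scale.
have I2 y : mu.-integrable setT (fun x => (F x y)%:E).
  apply: (@le_integrable _ _ _ mu setT measurableT _ (EFin \o (fun x => (`|C| * `|W y|) *
    `|W' x|))).
  - by apply/measurable_EFinP; exact: mF2.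
  - by move=> x _ /=; rewrite lee_fin; apply: le_trans (FC x y) _; rewrite mulrA;
    exact: ler_norm.
  - by apply: integrable_scale.
have IF : (mu \x mu)%E.-integrable setT (fun z : mR * mR => (F z.1 z.2)%:E).
  apply/integrable12ltyP; first exact/measurable_EFinP.
  pose N := \int[mu]_y `|W y|.
  have NE : (\int[mu]_y `|W y|%:E = N%:E)%E.
    by rewrite /N /Rintegral fineK//; exact: (integrable_fin_num measurableT IaW).
  have inner x : (\int[mu]_y `|F x y|%:E <= (`|C| * N * `|W' x|)%:E)%E.
    apply: (@le_trans _ _ (\int[mu]_y ((`|C| * `|W' x|)%:E * `|W y|%:E))%E).
      apply: ge0_le_integral => //.
      - by apply/measurable_EFinP; apply: nm; exact: mF1.
      - by apply/(@measurable_EFinP _ _ _ _ (fun y => `|C| * `|W' x| * `|W y|));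
        apply: measurable_funM => //; exact: nm.
      - by move=> y _; rewrite -EFinM lee_fin -mulrA (mulrC `|W' x|); exact: FC.
    rewrite ge0_integralZl//=.
    - by rewrite NE -EFinM lee_fin mulrAC.
    - by apply/measurable_EFinP; exact: nm.
  apply: (@le_lt_trans _ _ (\int[mu]_x (`|C| * N * `|W' x|)%:E)%E).
    apply: ge0_le_integral => //.
    - by move=> x _; apply: integral_ge0.
    - apply: (@measurable_fun_fubini_tonelli_F _ _ mR mR R mu (fun z => `|(F z.1
      z.2)%:E|%E)) => //.
      apply/(@measurable_EFinP _ _ _ _ (fun z : mR * mR => `|F z.1 z.2|)).
      exact: measurableT_comp.
    - by apply/measurable_EFinP; apply: measurable_funM => //; exact: nm.
    - by move=> x _; exact: inner.
  have := integrable_scale (`|C| * N) measurableT IaW'.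
  move=> /(integrable_fin_num measurableT) fin.
  by rewrite -ge0_fin_numE//; apply: integral_ge0 => x _;
    rewrite lee_fin !mulr_ge0// /N Rintegral_ge0.
have E := Rintegral_Fubini IF I1 I2.
have IKw x : J x -> mu.-integrable J (EFin \o (fun y => K x y * w y)).
  move=> Jx; have mKx : measurable_fun J (K x).
    exact: measurable_funTS (measurableT_comp mK (measurable_pair1 x)).
  exact: (integrable_bounded_mul mJ Iw mKx (fun y => KC x y Jx)).
have IKw' y : J y -> mu.-integrable J (EFin \o (fun x => K x y * w' x)).
  move=> Jy; have mKy : measurable_fun J (K^~ y).
    exact: measurable_funTS (measurableT_comp mK (measurable_pair2 y)).
  exact: (integrable_bounded_mul mJ Iw' mKy (fun x Jx => KC x y Jx Jy)).
have Foutl x y : ~ J x -> F x y = 0 by move=> Jx; rewrite /F (Wout' x Jx) !mulr0.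
have Foutr x y : ~ J y -> F x y = 0 by move=> Jy; rewrite /F (Wout y Jy) mul0r mulr0.
have Fin x y : J x -> J y -> F x y = K x y * (w y * w' x).
  by move=> Jx Jy; rewrite /F (Win y Jy) (Win' x Jx).
rewrite [LHS]Rintegral_mkcond [RHS]Rintegral_mkcond.
transitivity (\int[mu]_x (\int[mu]_y F x y));
  last (transitivity (\int[mu]_y (\int[mu]_x F x y))).
- apply: eq_Rintegral => x _; rewrite patchE; case: ifPn => [/set_mem Jx|/negP Jx].
  + rewrite -(RintegralZr _ mJ (IKw x Jx)) Rintegral_mkcond.
    apply: eq_Rintegral => y _; rewrite patchE; case: ifPn => [/set_mem Jy|/negP Jy].
      exact: etrans (esym (mulrA _ _ _)) (esym (Fin x y Jx Jy)).
    exact: (esym (Foutr x y (fun Jy' => Jy (mem_set Jy')))).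
  + apply: esym; apply: (Rintegral_zero measurableT) => y _.
    exact: (Foutl x y (fun Jx' => Jx (mem_set Jx'))).
- exact: E.
- apply: eq_Rintegral => y _; rewrite patchE; case: ifPn => [/set_mem Jy|/negP Jy].
  + rewrite -(RintegralZl _ mJ (IKw' y Jy)) [RHS]Rintegral_mkcond.
    apply: eq_Rintegral => x _; rewrite patchE; case: ifPn => [/set_mem Jx|/negP Jx].
      exact: etrans (Fin x y Jx Jy) (mulrCA _ _ _).
    exact: (Foutl x y (fun Jx' => Jx (mem_set Jx'))).
  + apply: (Rintegral_zero measurableT) => x _.
    exact: (Foutr x y (fun Jy' => Jy (mem_set Jy'))).
Qed.

End Green.

Section GreenReflection.
Context {R : realType}.
Notation mu := (@lebesgue_measure R).
Notation h := (@pi R / 2).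
Notation Om := (@Omega R).
Notation mR := (measurableTypeR R).

Definition green (l r x y : R) := tent l x r y / (r - l).

Lemma tent_in (l r x y : R) : l < y -> y < r ->
  tent l x r y = (r - x) * (y - l) - (r - l) * Num.max (y - x) 0.
Proof.
move=> ly yr; rewrite /tent (@max_l _ _ (y - l)) ?(@max_r _ _ (y - r)).
- by rewrite mulr0 addr0.
- lra.
- lra.
Qed.

Lemma tent_out (l r x y : R) : l <= x -> x <= r -> y <= l \/ r <= y -> tent l x r y = 0.
Proof.
move=> lx xr [yl|ry]; rewrite /tent.
- by rewrite !max_r; [ring|lra|lra|lra].
- by rewrite !max_l; [ring|lra|lra|lra].
Qed.

Lemma greenC (l r x y : R) : l < x < r -> l < y < r -> green l r x y = green l r y x.
Proof.
move=> /andP[lx xr] /andP[ly yr]; rewrite /green !tent_in//; congr (_ / _).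
have [xy|xy] := leP x y.
- by rewrite max_l ?max_r; [ring|lra|lra].
- by rewrite max_r ?max_l; [ring|lra|lra].
Qed.

Lemma green_reflection (l r x y : R) : l < x < r -> l < y < r ->
  green l r (l + r - x) (l + r - y) = green l r x y.
Proof.
move=> /andP[lx xr] /andP[ly yr]; rewrite /green !tent_in//; try lra.
congr (_ / _); have [xy|xy] := leP x y.
- by rewrite max_r ?max_l; [ring|lra|lra].
- by rewrite max_l ?max_r; [ring|lra|lra].
Qed.

Lemma measurable_green (l r : R) :
  measurable_fun setT (fun z : mR * mR => green l r z.1 z.2).
Proof.
have m1 : measurable_fun setT (fun z : mR * mR => z.1 : R) by exact: measurable_fst.
have m2 : measurable_fun setT (fun z : mR * mR => z.2 : R) by exact: measurable_snd.
rewrite /green /tent; apply: measurable_funM => //.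
apply: measurable_funD; [apply: measurable_funB|]; apply: measurable_funM => //;
  try apply: measurable_maxr => //; try exact: measurable_funB.
Qed.

Lemma green_le (l r x y : R) : l < x < r -> l < y < r -> `|green l r x y| <= 2 * (r - l).
Proof.
move=> /andP[lx xr] /andP[ly yr]; rewrite /green tent_in//.
have lr : 0 < r - l by lra.
rewrite normrM normfV (gtr0_norm lr) ler_pdivrMr// ler_norml.
have [xy|xy] := leP x y; last first.
  by rewrite max_r; [|lra]; rewrite mulr0 subr0; apply/andP; split; nra.
rewrite max_l; last lra.
by apply/andP; split; nra.
Qed.

(* The solution [u] of the Dirichlet problem [u'' = w] on [(l, r)], [u l = u r = A]. *)
Definition green_rep (l r A : R) (u w : R -> R) :=
  forall x, l < x < r -> u x = A - \int[mu]_(y in `]l, r[) (green l r x y * w y).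

Lemma green_rep_three_point (u w : R -> R) (l r : R) : - h <= l -> l < r -> r <= h ->
  {within `[- h, h], continuous u} -> mu.-integrable Om (EFin \o w) ->
  (forall phi, test_function phi ->
    \int[mu]_(x in Om) (u x * (phi^`()^`())%classic x) = \int[mu]_(x in Om) (w x * phi x)) ->
  u l = u r -> green_rep l r (u l) u w.
Proof.
move=> hl lr rh cu Iw weak ulr x /andP[lx xr].
have := three_point hl lx xr rh cu Iw weak; rewrite -ulr.
have JO : `]l, r[ `<=` Om.
  by move=> y; rewrite /Omega/= !in_itv/= => /andP[]; lra.
rewrite (@Rintegral_subset_support _ `]l, r[%classic)//; last first.
  move=> y _; rewrite /= in_itv/= => /negP; rewrite negb_and -!leNgt => yout.
  by rewrite (tent_out (ltW lx) (ltW xr) (orP yout)) mulr0.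
have lr0 : r - l != 0 by rewrite gt_eqF//; lra.
have Iw' : mu.-integrable `]l, r[ (EFin \o w).
  by apply: integrableS Iw => //; exact: measurable_OmegaR.
have mJ : measurable (`]l, r[%classic : set mR) by exact: measurable_itv.
have Ig : mu.-integrable `]l, r[ (EFin \o (fun y => green l r x y * w y)).
  have mg : measurable_fun `]l, r[ (green l r x).
    exact: measurable_funTS (measurableT_comp (measurable_green l r) (measurable_pair1 x)).
  apply: (integrable_bounded_mul (C := 2 * (r - l)) mJ Iw' mg) => y.
  by rewrite /= in_itv/= => yJ; apply: green_le => //; rewrite lx.
rewrite (_ : \int[mu]_(y in _) (w y * _) = (r - l) * \int[mu]_(y in `]l, r[) (green l r x y
  * w y)).
  move=> E; apply: (mulfI lr0); rewrite mulrBr -E; ring.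
rewrite -RintegralZl//; apply: eq_Rintegral => y _.
by rewrite /green; field.
Qed.

Section Symmetric.
Context (l r A A' : R) (u w u' w' : R -> R).
Let J : set mR := `]l, r[%classic.
Let tau x : R := l + r - x.
Context (su : sqint mu J u) (sw : sqint mu J w).
Context (su' : sqint mu J u') (sw' : sqint mu J w').
Context (ru : green_rep l r A u w) (ru' : green_rep l r A' u' w').

Let k (x y : R) := (green l r (tau x) y - green l r x y) / 2.

Let mJ : measurable J. Proof. exact: measurable_itv. Qed.

Let Jfin : (mu J < +oo)%E.
Proof. by rewrite /J lebesgue_measure_itv/=; case: ifP => // _; rewrite -EFinB ltry. Qed.

Let sqint_integrable f : sqint mu J f -> mu.-integrable J (EFin \o f).
Proof.
move=> sf; have s1 : sqint mu J (fun=> 1 : R).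
  by apply: (@sqint_bounded _ _ _ _ _ _ _ 1) => // x _; rewrite normr1.
have := sqint_mul mJ sf s1.
by apply: eq_integrable => // x _; rewrite mulr1.
Qed.

Let mk : measurable_fun setT (fun z : mR * mR => k z.1 z.2).
Proof.
rewrite /k; apply: measurable_funM => //; apply: measurable_funB.
- apply: (@measurableT_comp _ _ _ _ _ _ (fun z : mR * mR => green l r z.1 z.2) _ (fun z :
  mR * mR => (tau z.1, z.2))).
    exact: measurable_green.
  apply/measurable_fun_pairP; split => /=.
    by apply: measurable_funB => //; exact: measurable_fst.
  exact: measurable_snd.
- exact: measurable_green.
Qed.

Let Jtau x : J x -> J (tau x).
Proof. by rewrite /J/= !in_itv/= /tau => /andP[]; lra. Qed.

Let kC x y : J x -> J y -> k x y = k y x.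
Proof.
move=> Jx Jy; rewrite /k; congr (_ / _); congr (_ - _); last exact: greenC.
rewrite -green_reflection//; last exact: Jtau.
by rewrite /tau opprB addrCA subrr addr0 greenC//; exact: Jtau.
Qed.

Let k_le x y : J x -> J y -> `|k x y| <= 2 * (r - l).
Proof.
move=> Jx Jy; rewrite /k.
have := green_le Jx Jy; have := green_le (Jtau Jx) Jy.
by rewrite !ler_norml; lra.
Qed.

Let rep_antisym B (v z : R -> R) : sqint mu J z -> green_rep l r B v z ->
  forall x, J x -> antisym tau v x = \int[mu]_(y in J) (k x y * z y).
Proof.
move=> sz rv x Jx; rewrite /antisym (rv x)// (rv (tau x)); last exact: Jtau.
have Iz := sqint_integrable sz.
have Ig x' : J x' -> mu.-integrable J (EFin \o (fun y => green l r x' y * z y)).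
  move=> Jx'; have mg : measurable_fun J (green l r x').
    exact: measurable_funTS (measurableT_comp (measurable_green l r) (measurable_pair1 x')).
  by apply: (integrable_bounded_mul (C := 2 * (r - l)) mJ Iz mg) => y Jy; exact: green_le.
have -> : \int[mu]_(y in J) (k x y * z y) =
   2^-1 * (\int[mu]_(y in J) (green l r (tau x) y * z y) -
           \int[mu]_(y in J) (green l r x y * z y)).
  rewrite -(RintegralB mJ (Ig _ (Jtau Jx)) (Ig _ Jx)) -RintegralZl//.
    by apply: eq_Rintegral => y _; rewrite /k; field.
  have := integrableB mJ (Ig _ (Jtau Jx)) (Ig _ Jx).
  by apply: eq_integrable => // y _; rewrite /= EFinB.
by rewrite [_ / 2]mulrC; congr (_ * _); rewrite /J; ring.
Qed.

Lemma green_antisym_symmetric :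
  ip mu J (antisym tau u) w' = ip mu J (antisym tau w) u'.
Proof.
have invt : measure_involution mu J tau by exact: reflection_involution.
rewrite (ip_antisym mJ invt sw su') /ip.
have Iw := sqint_integrable sw; have Iw' := sqint_integrable sw'.
transitivity (\int[mu]_(x in J) ((\int[mu]_(y in J) (k x y * w y)) * w' x)).
  by apply: eq_Rintegral => x /set_mem Jx; rewrite (rep_antisym sw ru Jx).
rewrite (kernel_Fubini mJ mk k_le Iw Iw').
apply: eq_Rintegral => y /set_mem Jy; congr (_ * _).
apply: etrans (esym (rep_antisym sw' ru' Jy)).
by apply: eq_Rintegral => x /set_mem Jx; rewrite kC.
Qed.

End Symmetric.
End GreenReflection.

Section Intertwining.
Context {R : realType}.
Notation mu := (@lebesgue_measure R).
Notation h := (@pi R / 2).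
Notation Om := (@Omega R).
Notation mR := (measurableTypeR R).

Lemma sqint_subset (D E : set mR) (f : R -> R) : measurable E -> measurable D ->
  D `<=` E -> sqint mu E f -> sqint mu D f.
Proof.
move=> mE mD DE [mf If]; split; first exact: measurable_funS mf.
exact: integrableS If.
Qed.

Lemma Rintegral_split (l c r : R) (f : R -> R) : l < c < r ->
  mu.-integrable `]l, r[ (EFin \o f) ->
  \int[mu]_(x in `]l, r[) f x =
  \int[mu]_(x in `]l, c[) f x + \int[mu]_(x in `]c, r[) f x.
Proof.
move=> lcr If; have [lc cr] := andP lcr.
have m0 : measurable (`]l, r[%classic : set mR) by exact: measurable_itv.
have m1 : measurable (`]l, c[%classic : set mR) by exact: measurable_itv.
have m2 : measurable (`]c, r[%classic : set mR) by exact: measurable_itv.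
have I1 : mu.-integrable `]l, c[ (EFin \o f).
  by apply: integrableS If => // x; rewrite /= !in_itv/= => /andP[]; lra.
have I2 : mu.-integrable `]c, r[ (EFin \o f).
  by apply: integrableS If => // x; rewrite /= !in_itv/= => /andP[]; lra.
rewrite /Rintegral (integral_split lcr); last by case/integrableP : If.
by rewrite fineD//; exact: integrable_fin_num.
Qed.

Lemma ip_antisym_flip2 (l c r : R) (f g : R -> R) : l < c < r ->
  sqint mu `]l, r[ f -> sqint mu `]l, r[ g ->
  ip mu `]l, r[ (antisym (flip2 l c r) f) g =
  ip mu `]l, c[ (antisym (fun x : R => l + c - x) f) g +
  ip mu `]c, r[ (antisym (fun x : R => c + r - x) f) g.
Proof.
move=> lcr sf sg; rewrite /ip.
have m0 : measurable (`]l, r[%classic : set mR) by exact: measurable_itv.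
have sa := sqint_antisym m0 (flip2_involution lcr) sf.
rewrite (Rintegral_split lcr (sqint_mul m0 sa sg)); congr (_ + _).
- apply: eq_Rintegral => x; rewrite inE/= in_itv/= => /andP[_ xc].
  by rewrite /antisym flip2_lt.
- apply: eq_Rintegral => x; rewrite inE/= in_itv/= => /andP[xc _].
  by rewrite /antisym flip2_gt.
Qed.

Section WithParameter.
Context (a : R).
Context (ha : -1 < a < 1).

Definition phi0r (x : R) : R :=
  if x < h * a then (a - 1) * (x + h) else (a + 1) * (x - h).

Definition sigma (x : R) := - h + h - x.
Definition tau (x : R) := flip2 (- h) (h * a) h x.

Lemma jump_lt : - h < h * a < h.
Proof. by case/andP: ha => a1 a2; have h0 := @pihalf_gt0 R; apply/andP; split; nra. Qed.

Lemma sigma_involution : measure_involution mu Om sigma.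
Proof. exact: reflection_involution. Qed.

Lemma tau_involution : measure_involution mu Om tau.
Proof. exact: (flip2_involution jump_lt). Qed.

Lemma continuous_sqint (u : R -> R) : {within `[- h, h], continuous u} -> sqint mu Om u.
Proof.
move=> cu; have [C C0 uC] := continuous_bounded_Omega cu.
apply: (sqint_bounded measurable_OmegaR Omega_fin _ uC).
by have /integrableP[/measurable_EFinP] := continuous_integrable_Omega cu.
Qed.

Lemma sqint_phi0r : sqint mu Om phi0r.
Proof.
have /andP[a1 a2] := ha; have h0 := @pihalf_gt0 R; have /andP[c1 c2] := jump_lt.
apply: (@sqint_bounded _ _ _ _ _ measurable_OmegaR _ (4 * h) Omega_fin).
- apply/(measurable_fun_split _ jump_lt); split.
  + have m : measurable_fun `](- h), (h * a)[ (fun x : R => (a - 1) * (x + h)).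
      by apply: measurable_funM => //; exact: measurable_funD.
    move: m; apply: eq_measurable_fun => x.
    by rewrite inE/= in_itv/= => /andP[_ xc]; rewrite /phi0r xc.
  + have m : measurable_fun `](h * a), h[ (fun x : R => (a + 1) * (x - h)).
      by apply: measurable_funM => //; exact: measurable_funB.
    move: m; apply: eq_measurable_fun => x.
    by rewrite inE/= in_itv/= => /andP[cx _]; rewrite /phi0r ltNge (ltW cx).
- move=> x; rewrite /Omega/= in_itv/= => /andP[x1 x2]; rewrite /phi0r ler_norml.
  by case: ifP => _; apply/andP; split; nra.
Qed.

(* The pairs (psi, psi'') with [psi] real-valued in the domain of [H]; the first
   derivative is never needed. *)
Record jump_pair (u w : R -> R) : Prop := JumpPair {
  jump_continuous : {within `[- h, h], continuous u} ;
  jump_sqint : sqint mu Om w ;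
  jump_weak : forall phi, test_function phi ->
    \int[mu]_(x in Om) (u x * (phi^`()^`())%classic x) = \int[mu]_(x in Om) (w x * phi x) ;
  jump_left : u (- h) = u (h * a) ;
  jump_right : u (h * a) = u h }.

Lemma sqint_integrable_Omega (f : R -> R) : sqint mu Om f -> mu.-integrable Om (EFin \o f).
Proof.
move=> sf; have s1 : sqint mu Om (fun=> 1 : R).
  apply: (@sqint_bounded _ _ _ _ _ measurable_OmegaR _ 1 Omega_fin) => // x _.
  by rewrite normr1.
have := sqint_mul measurable_OmegaR sf s1.
by apply: eq_integrable => [|x _]; [exact: measurable_OmegaR|rewrite mulr1].
Qed.

Lemma tent_phi0r x : Om x -> tent (- h) (h * a) h x = - h * phi0r x.
Proof.
rewrite /Omega/= in_itv/= => /andP[x1 x2]; rewrite tent_in// /phi0r.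
by case: ifPn => [xc|]; [|rewrite -leNgt => xc]; [rewrite max_r|rewrite max_l];
  [ring|lra|ring|lra].
Qed.

Lemma ip_phi0r_three_point (u w : R -> R) : {within `[- h, h], continuous u} ->
  sqint mu Om w ->
  (forall phi, test_function phi ->
    \int[mu]_(x in Om) (u x * (phi^`()^`())%classic x) = \int[mu]_(x in Om) (w x * phi x)) ->
  ip mu Om phi0r w = 2 * u (h * a) - (1 - a) * u (- h) - (1 + a) * u h.
Proof.
move=> cu sw weak; have /andP[c1 c2] := jump_lt; have h0 := @pihalf_gt0 R.
have := three_point (lexx _) c1 c2 (lexx _) cu (sqint_integrable_Omega sw) weak.
have -> : \int[mu]_(y in Om) (w y * tent (- h) (h * a) h y) = - h * ip mu Om phi0r w.
  rewrite /ip -(RintegralZl (- h) measurable_OmegaR (sqint_mul measurable_OmegaR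
    sqint_phi0r sw)).
  by apply: eq_Rintegral => x /set_mem Ox; rewrite tent_phi0r//; ring.
move=> E; have h1 : - h != 0 by rewrite oppr_eq0 gt_eqF.
by apply: (mulfI h1); rewrite -E; ring.
Qed.

Lemma ip_phi0r_jump u w : jump_pair u w -> ip mu Om phi0r w = 0.
Proof.
by case=> cu sw weak ul ur; rewrite (ip_phi0r_three_point cu sw weak) ul -ur; ring.
Qed.

Notation T := (metric_op mu Om phi0r sigma tau).

Lemma jump_green u w l r : jump_pair u w -> - h <= l -> l < r -> r <= h ->
  u l = u r -> green_rep l r (u l) u w.
Proof.
move=> [cu sw weak _ _] hl lr rh.
exact: green_rep_three_point hl lr rh cu (sqint_integrable_Omega sw) weak.
Qed.

Lemma metric_op_intertwines u w u' w' : jump_pair u w -> jump_pair u' w' ->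
  ip mu Om (T u) w' = ip mu Om (T w) u'.
Proof.
move=> J J'; have /andP[c1 c2] := jump_lt; have h0 := @pihalf_gt0 R.
have su := continuous_sqint (jump_continuous J).
have su' := continuous_sqint (jump_continuous J').
have sw := jump_sqint J; have sw' := jump_sqint J'.
have mO := @measurable_OmegaR R.
rewrite !(ip_metric_opl mO sqint_phi0r sigma_involution tau_involution)//.
rewrite (ip_phi0r_jump J) (ip_phi0r_jump J') mulr0 mul0r !add0r.
have sym l r : - h <= l -> l < r -> r <= h -> u l = u r -> u' l = u' r ->
    ip mu `]l, r[ (antisym (fun x : R => l + r - x) u) w' =
    ip mu `]l, r[ (antisym (fun x : R => l + r - x) w) u'.
  move=> hl lr rh e e'.
  have mlr : measurable (`]l, r[%classic : set mR) by exact: measurable_itv.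
  have sub : `]l, r[%classic `<=` Om.
    by move=> x; rewrite /Omega/= !in_itv/= => /andP[]; lra.
  apply: (@green_antisym_symmetric R l r (u l) (u' l)); try exact: sqint_subset sub _.
  - exact: jump_green.
  - exact: jump_green.
congr (_ + _).
- apply: sym => //; first lra.
  + by rewrite (jump_left J) (jump_right J).
  + by rewrite (jump_left J') (jump_right J').
- rewrite /tau /Omega !(ip_antisym_flip2 jump_lt)//; congr (_ + _); apply: sym => //; try lra.
  + exact: jump_left J.
  + exact: jump_left J'.
  + exact: jump_right J.
  + exact: jump_right J'.
Qed.

End WithParameter.
End Intertwining.

(** * Density of the domain *)

Section Density.
Context {R : realType}.
Notation mu := (@lebesgue_measure R).
Notation h := (@pi R / 2).
Notation Om := (@Omega R).
Notation mR := (measurableTypeR R).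

Lemma Rintegral_Omega_closed (f : R -> R) : {within `[- h, h], continuous f} ->
  \int[mu]_(x in Om) f x = \int[mu]_(x in `[- h, h]) f x.
Proof.
move=> cf; rewrite /Rintegral -(@integral_itv_bndoo R (- h) h (EFin \o f) true false)//.
by have /integrableP[] := continuous_integrable_Omega cf.
Qed.

Lemma test_function_derive (phi : R -> R) : test_function phi ->
  (forall x : R, is_derive x 1 phi (phi^`()%classic x)) /\ continuous phi^`()%classic.
Proof.
move=> [sm _]; split=> x.
- by split; [exact: (sm 0)|rewrite derive1E].
- apply: differentiable_continuous; apply/derivable1_diffP.
  by rewrite -derive1n1; exact: sm.
Qed.

Lemma test_function_derive1 (phi : R -> R) : test_function phi ->
  test_function phi^`()%classic.
Proof.
move=> [sm [c [d [cd phi0]]]]; split.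
  by move=> n x; rewrite -derive1Sn; exact: sm.
exists c, d; split=> // x; rewrite in_itv/= negb_and -!ltNge => xcd.
rewrite (@near_eq_derive1 _ _ (fun=> 0)); first by rewrite derive1_cst.
case/orP: xcd => [xc|dx].
- near=> y; apply: phi0; rewrite in_itv/= negb_and -!ltNge; apply/orP; left.
  by near: y; exact: lt_nbhsl.
- near=> y; apply: phi0; rewrite in_itv/= negb_and -!ltNge; apply/orP; right.
  by near: y; exact: lt_nbhsr.
Unshelve. all: by end_near. Qed.

Lemma test_function_boundary (phi : R -> R) : test_function phi ->
  phi (- h) = 0 /\ phi h = 0.
Proof.
move=> [_ [c [d [cd phi0]]]]; split; apply: phi0; apply/negP => /cd;
  by rewrite /Omega/= in_itv/= ltxx ?andbF.
Qed.

Lemma integration_by_parts_test (u u' phi : R -> R) :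
  (forall x : R, is_derive x 1 u (u' x)) -> continuous u' -> test_function phi ->
  \int[mu]_(x in Om) (u x * phi^`()%classic x) = - \int[mu]_(x in Om) (u' x * phi x).
Proof.
move=> du cu' tphi; have [dphi cphi'] := test_function_derive tphi.
have [pl pr] := test_function_boundary tphi.
have cu : continuous u by move=> x; exact: is_derive_continuous (du x).
have cphi : continuous phi by move=> x; exact: is_derive_continuous (dphi x).
have c1 : continuous (fun x => u' x * phi x) by move=> x; apply: cvgM;
  [exact: cu'|exact: cphi].
have c2 : continuous (fun x => u x * phi^`()%classic x) by move=> x; apply: cvgM;
  [exact: cu|exact: cphi'].
have c12 : continuous (fun x => u' x * phi x + u x * phi^`()%classic x).
  by move=> x; apply: cvgD; [exact: c1|exact: c2].
have hh : - h < h by have := @pihalf_gt0 R; lra.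
have d12 (x : R) : is_derive x 1 (fun x => u x * phi x) (u' x * phi x + u x *
  phi^`()%classic x).
  exact: is_derive_mul.
have := Rintegral_FTC hh d12 c12; rewrite pl pr !mulr0 subrr.
rewrite -Rintegral_Omega_closed; last exact: continuous_subspaceT.
rewrite (RintegralD (@measurable_OmegaR R)).
- by move=> /eqP; rewrite addrC addr_eq0 => /eqP.
- by apply: continuous_integrable_Omega; exact: continuous_subspaceT.
- by apply: continuous_integrable_Omega; exact: continuous_subspaceT.
Qed.

Lemma ae_eq0_interval (f : R -> R) (c : R) : mu.-integrable Om (EFin \o f) ->
  (forall s t, - h < s -> s < t -> t < h -> t < c \/ c < s -> \int[mu]_(x in `]s, t[) f x =
    0) ->
  ae_eq mu Om f (fun=> 0).
Proof.
move=> If f0; pose g := f \_ Om.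
have mO := @measurable_OmegaR R.
have Ig : mu.-integrable setT (EFin \o g).
  by move: If; rewrite integrable_mkcond// restrict_EFin.
have Igs (D : set mR) : measurable D -> mu.-integrable D (EFin \o g).
  by move=> mD; exact: integrableS Ig.
have gloc : locally_integrable setT g by exact: integrable_locally.
have := FTC1Ny (fun y => Igs _ (measurable_itv _)) gloc.
set F := fun x => _.
have aec : {ae mu, forall x, x <> c}.
  exists [set c]; split; [exact: measurable_set1|exact: lebesgue_measure_set1|].
  by move=> x /=; apply: contrapT.
apply: filterS2 aec; first exact: (ae_filter_ringOfSetsType mu).
move=> x xc [dF dFx] Ox.
have gx : g x = f x by rewrite /g patchE mem_set.
rewrite -gx -dFx.
have step s t : - h < s -> s < t -> t < h -> t < c \/ c < s -> F t = F s.
  move=> hs st th stc; apply/eqP; rewrite -subr_eq0; apply/eqP.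
  rewrite /F (@Rintegral_itvB _ g -oo%O (BRight t) s)//; last 2 first.
  - exact: Igs.
  - by rewrite bnd_simp ltW.
  rewrite -Rintegral_itv_bndo_bndc; last exact: Igs.
  rewrite -(f0 s t)//; apply: eq_Rintegral => y; rewrite inE/= in_itv/= => /andP[y1 y2].
  by rewrite /g patchE mem_set// /Omega/= in_itv/=; lra.
move: Ox; rewrite /Omega/= in_itv/= => /andP[hx xh].
rewrite (@near_eq_derive1 _ _ (fun=> F x)); first by rewrite derive1_cst.
have [xc'|cx'|//] := ltgtP x c.
- near=> y.
  have y1 : - h < y by near: y; exact: lt_nbhsr.
  have y2 : y < h by near: y; exact: lt_nbhsl.
  have y3 : y < c by near: y; exact: lt_nbhsl.
  have [yx|xy|->//] := ltgtP y x.
  + by rewrite -(step y x)//; left.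
  + by rewrite (step x y)//; left.
- near=> y.
  have y1 : - h < y by near: y; exact: lt_nbhsr.
  have y2 : y < h by near: y; exact: lt_nbhsl.
  have y3 : c < y by near: y; exact: lt_nbhsr.
  have [yx|xy|->//] := ltgtP y x.
  + by rewrite -(step y x)//; right.
  + by rewrite (step x y)//; right.
Unshelve. all: by end_near. Qed.

Definition bump (s t : R) (n : nat) (x : R) :=
  smooth_step (n%:R * x + - (n%:R * s)) * smooth_step ((- n%:R) * x + n%:R * t).

Lemma elem_bump s t n : elem (bump s t n).
Proof. by apply: elemM; apply: elem_affine; exact: elem_step. Qed.

Lemma bump_out s t n x : x <= s \/ t <= x -> bump s t n x = 0.
Proof.
have n0 : 0 <= n%:R :> R by [].
rewrite /bump => -[xs|tx]; [rewrite step_le0 ?mul0r//|rewrite mulrC step_le0 ?mul0r//]; nra.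
Qed.

Lemma bump_ge0 s t n x : 0 <= bump s t n x.
Proof. by rewrite mulr_ge0// step_ge0. Qed.

Lemma bump_le1 s t n x : bump s t n x <= 1.
Proof. by rewrite /bump mulr_ile1 ?step_ge0 ?step_le1. Qed.

Lemma bump_cvg s t x : s < x < t -> bump s t n x @[n --> \oo] --> (1 : R).
Proof.
move=> /andP[sx xt]; apply: cvg_near_cst; near=> n.
have h1 : 1 <= n%:R * (x - s).
  rewrite -ler_pdivrMr ?subr_gt0// div1r; near: n; exact: nbhs_infty_ger.
have h2 : 1 <= n%:R * (t - x).
  rewrite -ler_pdivrMr ?subr_gt0// div1r; near: n; exact: nbhs_infty_ger.
by rewrite /bump !step_ge1 ?mulr1//; nra.
Unshelve. all: by end_near. Qed.

Lemma bump_integral0 (f : R -> R) (s t : R) : - h < s -> s < t -> t < h ->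
  mu.-integrable Om (EFin \o f) ->
  (forall n, \int[mu]_(x in Om) (f x * bump s t n x) = 0) ->
  \int[mu]_(x in `]s, t[) f x = 0.
Proof.
move=> hs st th If f0; have mO := @measurable_OmegaR R.
have mf : measurable_fun Om f by case/integrableP : If => /measurable_EFinP.
have sub : `]s, t[ `<=` Om.
  by move=> x; rewrite /Omega/= !in_itv/= => /andP[]; lra.
have mst : measurable (`]s, t[%classic : set mR) by exact: measurable_itv.
have Ist : mu.-integrable `]s, t[ (EFin \o f) by exact: integrableS If.
have mb n : measurable_fun `]s, t[ (bump s t n).
  by apply: measurable_funTS; apply: continuous_measurable_fun; apply: elem_continuous;
    exact: elem_bump.
have E n : (\int[mu]_(x in `]s, t[) (f x * bump s t n x)%:E = 0)%E.
  have Ib : mu.-integrable `]s, t[ (EFin \o (fun x => f x * bump s t n x)).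
    apply: (integrable_mul_bounded (C := 1) mst Ist (mb n)) => x _.
    by rewrite ger0_norm ?bump_ge0// bump_le1.
  have := f0 n; rewrite (@Rintegral_subset_support _ `]s, t[%classic)//; last first.
    move=> x _; rewrite /= in_itv/= => /negP; rewrite negb_and -!leNgt => /orP xst.
    by rewrite bump_out// mulr0.
  by move=> E0; rewrite -[LHS](fineK (integrable_fin_num mst Ib)); congr EFin; exact: E0.
rewrite /Rintegral; suff -> : (\int[mu]_(x in `]s, t[) (f x)%:E = 0)%E by [].
have cv : (\int[mu]_(x in `]s, t[) (f x * bump s t n x)%:E @[n --> \oo] -->
    \int[mu]_(x in `]s, t[) (f x)%:E)%E.
  apply: (@dominated_cvg _ _ _ mu _ mst (fun n x => (f x * bump s t n x)%:E) _
    (fun x => `|f x|%:E)).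
  - move=> n; apply/measurable_EFinP; apply: measurable_funM; last exact: mb.
    exact: measurable_funS mf.
  - move=> x; rewrite /= in_itv/= => xst; apply: cvg_EFin; first exact: nearW.
    rewrite -[X in _ --> X]mulr1; apply: cvgM; first exact: cvg_cst.
    exact: bump_cvg.
  - by [].
  - exact: integrable_norm.
  - move=> n x _; rewrite /= lee_fin normrM ler_piMr//.
    by rewrite ger0_norm ?bump_ge0// bump_le1.
apply: (cvg_unique _ cv) => //.
rewrite (_ : (fun n => _) = fun=> 0%E); first exact: cvg_cst.
by apply/funext => n; exact: E.
Qed.

End Density.

(** * Irrational rotations and injectivity *)

Section SmallCombinations.
Context {R : realType}.

(* Each step of the Euclidean algorithm can be made to halve the element. *)
Lemma small_combination (alpha e : R) : irrational alpha -> 0 < e ->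
  exists m n : int, 0 < m%:~R * alpha + n%:~R < e.
Proof.
move=> irr e0.
pose G (d : R) := 0 < d /\ exists m n : int, d = m%:~R * alpha + n%:~R.
have halve d : G d -> exists2 d', G d' & d' <= d / 2.
  move=> [d0 [m [n dE]]].
  have red (y : R) (p q : int) : y = p%:~R * alpha + q%:~R ->
      y != (Num.floor (y / d))%:~R * d -> exists2 d', G d' & d' <= d / 2.
    move=> yE; set k := Num.floor _ => yk.
    have /andP[k1 k2] := floor_itv (y / d); rewrite -/k in k1 k2.
    have r0 : 0 < y - k%:~R * d.
      by rewrite lt_neqAle eq_sym subr_eq0 yk subr_ge0 -ler_pdivlMr.
    have rd : y - k%:~R * d < d.
      by move: k2; rewrite ltr_pdivrMr// intrD1 mulrDl mul1r; lra.
    have [rh|rh] := leP (y - k%:~R * d) (d / 2).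
    - exists (y - k%:~R * d) => //; split=> //; exists (p - k * m), (q - k * n).
      by rewrite yE dE !rmorphB !rmorphM/=; ring.
    - exists (d - (y - k%:~R * d)); last lra.
      split; first by rewrite subr_gt0.
      exists (m - (p - k * m)), (n - (q - k * n)).
      by rewrite yE [X in X - _]dE dE !rmorphB !rmorphM/=; ring.
  have [e1|] := eqVneq (1 : R) ((Num.floor (1 / d))%:~R * d); last first.
    by apply: (red 1 0 1); rewrite mul0r add0r.
  have [e2|] := eqVneq alpha ((Num.floor (alpha / d))%:~R * d); last first.
    by apply: (red alpha 1 0); rewrite mul1r addr0.
  exfalso; apply: irr; apply/rationalP.
  set k := Num.floor (1 / d) in e1; set j := Num.floor (alpha / d) in e2.
  have k0 : 0 < k by rewrite -(ltr0z R) -(pmulr_lgt0 _ d0) -e1.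
  exists j, `|k|%N; rewrite natr_absz gtr0_norm//.
  have kz : k%:~R != 0 :> R by rewrite intr_eq0 gt_eqF.
  have dk : d = (k%:~R)^-1 by apply: (mulfI kz); rewrite -e1 divff.
  by apply: etrans e2 _; rewrite dk.
have all_n N : exists2 d, G d & d <= 2^-1 ^+ N.
  elim: N => [|N [d Gd dN]].
    exists 1; last by rewrite expr0.
    by split=> //; exists 0, 1; rewrite mul0r add0r.
  have [d' Gd' dd'] := halve d Gd; exists d' => //.
  by apply: le_trans dd' _; rewrite exprSr ler_wpM2r.
have : (2^-1 : R) ^+ N @[N --> \oo] --> (0 : R).
  by apply: cvg_expr; rewrite ger0_norm// invf_lt1// ltr1n.
move=> /cvgrPdist_lt/(_ _ e0)[N _ /(_ N (leqnn _))].
rewrite sub0r normrN ger0_norm ?exprn_ge0// => Ne.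
have [d [d0 [m [n dE]]] dN] := all_n N.
by exists m, n; rewrite -dE d0 (le_lt_trans dN).
Qed.

Lemma irrational_half (a : R) : irrational a -> irrational ((1 + a) / 2).
Proof.
move=> irr /rationalP[p [q E]]; apply: irr; apply/rationalP.
have [q0|q0] := eqVneq q 0%N.
  exists (-1), 1%N; move: E; rewrite q0 invr0 mulr0 => E; lra.
exists (p * 2 - q%:Z), q; rewrite rmorphB rmorphM/= -pmulrn mulrBl divff ?pnatr_eq0//.
have : 1 + a = (p%:~R / q%:R) * 2 by rewrite -E divfK.
by move=> E2; apply: (addrI 1); rewrite E2; ring.
Qed.

End SmallCombinations.

Section Injectivity.
Context {R : realType}.
Notation mu := (@lebesgue_measure R).
Notation h := (@pi R / 2).
Notation Om := (@Omega R).
Notation mR := (measurableTypeR R).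

Lemma weak_second_derivative_C2 (u u' u'' : R -> R) : (forall x : R, is_derive x 1 u (u' x)) ->
  (forall x : R, is_derive x 1 u' (u'' x)) -> continuous u'' ->
  forall phi, test_function phi ->
  \int[mu]_(x in Om) (u x * (phi^`()^`())%classic x) = \int[mu]_(x in Om) (u'' x * phi x).
Proof.
move=> du du' cu'' phi tphi.
have cu' : continuous u' by move=> x; exact: is_derive_continuous (du' x).
rewrite (integration_by_parts_test du cu' (test_function_derive1 tphi)).
by rewrite (integration_by_parts_test du' cu'' tphi) opprK.
Qed.

Section Primitive.
Context (f : R -> R).
Context (sf : sqint mu Om f).

Definition primitive (x y : R) : R := \int[mu]_(z in `]x, y[) f z.

Lemma sub_Omega (x y : R) : - h <= x -> y <= h -> `]x, y[%classic `<=` Om.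
Proof. by move=> hx yh z; rewrite /Omega/= !in_itv/= => /andP[]; lra. Qed.

Lemma integrable_sub (x y : R) : - h <= x -> y <= h -> mu.-integrable `]x, y[ (EFin \o f).
Proof.
move=> hx yh; have mD : measurable (`]x, y[%classic : set mR) by exact: measurable_itv.
exact: (integrableS (@measurable_OmegaR R) mD (sub_Omega hx yh) (sqint_integrable_Omega sf)).
Qed.

Lemma primitivexx x : primitive x x = 0.
Proof. by rewrite /primitive set_itvE Rintegral_set0. Qed.

Lemma primitive_add (x y z : R) : - h <= x -> x <= y -> y <= z -> z <= h ->
  primitive x z = primitive x y + primitive y z.
Proof.
move=> hx; rewrite le_eqVlt => /predU1P[-> _ _|xy]; first by rewrite primitivexx add0r.
rewrite le_eqVlt => /predU1P[-> _|yz zh]; first by rewrite primitivexx addr0.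
by rewrite /primitive (@Rintegral_split R x y z) ?xy//; exact: integrable_sub.
Qed.

Lemma primitive_sqr_le (x y : R) : - h <= x -> x <= y -> y <= h ->
  primitive x y ^+ 2 <= (y - x) * ip mu Om f f.
Proof.
move=> hx xy yh; pose D := (`]x, y[%classic : set mR).
have mD : measurable D by exact: measurable_itv.
have mO := @measurable_OmegaR R.
have DO : D `<=` Om by exact: sub_Omega.
have muD : mu D = (y - x)%:E.
  by rewrite /D lebesgue_measure_itv/= lte_fin; case: ltgtP xy => // -> _; rewrite subrr.
have Dfin : (mu D < +oo)%E by rewrite muD ltry.
have s1 : sqint mu D (fun=> 1 : R).
  by apply: (@sqint_bounded _ _ _ _ _ mD _ 1 Dfin) => // z _; rewrite normr1.
have sfD : sqint mu D f by exact: sqint_subset DO sf.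
have := ip_CauchySchwarz mD sfD s1.
have -> : ip mu D f (fun=> 1) = primitive x y.
  by apply: eq_Rintegral => z _; rewrite mulr1.
have -> : ip mu D (fun=> 1) (fun=> 1) = y - x.
  by rewrite /ip (Rintegral_cst mu mD (1 * 1)) !mul1r (congr1 fine muD).
move=> /le_trans; apply; rewrite mulrC ler_wpM2l ?subr_ge0//.
apply: fine_le.
- exact: (integrable_fin_num mD (sqint_mul mD sfD sfD)).
- exact: (integrable_fin_num mO (sqint_mul mO sf sf)).
- apply: ge0_subset_integral => //.
  + by have /integrableP[] := sqint_mul mO sf sf.
  + by move=> z _; rewrite lee_fin -expr2 sqr_ge0.
Qed.

Lemma primitive_flip (l r x : R) : - h <= l -> l <= x -> x <= r -> r <= h ->
  ae_eq mu `]l, r[%classic f (fun y => f (l + r - y)) -> primitive x r = primitive l (l + r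
    - x).
Proof.
move=> hl lx xr rh fE; rewrite /primitive /Rintegral; congr fine.
have mf u v : - h <= u -> v <= h -> measurable_fun `]u, v[ f.
  by move=> hu vh; have /integrableP[/measurable_EFinP] := integrable_sub hu vh.
have m1 : measurable_fun `]l, (l + r - x)[ f by apply: mf => //; lra.
rewrite -(integral_reflection (l + r) m1).
have -> : l + r - (l + r - x) = x by ring.
have -> : l + r - l = r by ring.
apply: ae_eq_integral; first exact: measurable_itv.
- by apply/measurable_EFinP; apply: mf => //; lra.
- apply/measurable_EFinP; have := measurable_fun_reflection (b := l + r) m1.
  have -> : l + r - (l + r - x) = x by ring.
  by have -> : l + r - l = r by ring.
- apply: filterS fE => y fy; rewrite /= in_itv/= => /andP[xy yr]; rewrite fy//.
  by rewrite /= in_itv/=; lra.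
Qed.

End Primitive.

Section Rotation.
Context (a : R).
Context (ha : -1 < a < 1) (irr : irrational a).
Notation c := (h * a).
Notation sigma := (@sigma R).
Notation tau := (@tau R a).

Section Invariant.
Context (f : R -> R).
Context (sf : sqint mu Om f).
Context (f_sigma : ae_eq mu Om (antisym sigma f) (fun=> 0)).
Context (f_tau : ae_eq mu Om (antisym tau f) (fun=> 0)).
Context (f_mean : \int[mu]_(x in Om) f x = 0).

Let Phi (x : R) : R := primitive f (- h) x.
Let B : R := ip mu Om f f.

Let B0 : 0 <= B. Proof. exact: ip_ge0. Qed.

Let h0 : 0 < h. Proof. exact: pihalf_gt0. Qed.

Let antisym0 (s : R -> R) x : antisym s f x = 0 -> f x = f (s x).
Proof. by rewrite /antisym => /eqP; rewrite mulf_eq0 invr_eq0 pnatr_eq0 orbF subr_eq0 =>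
  /eqP. Qed.

Let Phi_sqr (x : R) : - h <= x -> x <= h -> Phi x ^+ 2 <= (x + h) * B.
Proof. by move=> hx xh; have := primitive_sqr_le sf (lexx _) hx xh; rewrite opprK. Qed.

Let Phi_right : Phi h = 0. Proof. exact: f_mean. Qed.

Let primitive_Phi (x y : R) : - h <= x -> x <= y -> y <= h -> primitive f x y = Phi y - Phi x.
Proof. by move=> hx xy yh; rewrite /Phi (primitive_add sf (lexx _) hx xy yh) addrC addKr. Qed.

Let Phi_sigma (x : R) : - h <= x -> x <= h -> Phi (- x) = - Phi x.
Proof.
move=> hx xh; have : primitive f x h = primitive f (- h) (- h + h - x).
  by apply: primitive_flip => //; apply: filterS f_sigma => y fy Oy;
    rewrite (antisym0 (fy Oy)).
by rewrite addNr sub0r primitive_Phi// Phi_right sub0r => ->.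
Qed.

Let Phi_tau (x : R) : - h <= x -> x <= h -> Phi (tau x) = Phi c - Phi x.
Proof.
move=> hx xh; have /andP[c1 c2] := jump_lt ha; rewrite /tau /flip2; case: ifPn => [xc|].
- have : primitive f x c = primitive f (- h) (- h + c - x).
    apply: primitive_flip => //; try exact: ltW.
    apply: filterS f_tau => y fy; rewrite /= in_itv/= => /andP[y1 y2].
    have Oy : Om y by rewrite /Omega/= in_itv/= y1 (lt_trans y2 c2).
    by rewrite (antisym0 (fy Oy)) /tau flip2_lt.
  by rewrite primitive_Phi//; exact: ltW.
- rewrite -leNgt => cx.
  have : primitive f x h = primitive f c (c + h - x).
    apply: primitive_flip => //; first exact: ltW.
    apply: filterS f_tau => y fy; rewrite /= in_itv/= => /andP[y1 y2].
    have Oy : Om y by rewrite /Omega/= in_itv/= y2 (lt_trans c1 y1).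
    by rewrite (antisym0 (fy Oy)) /tau flip2_gt.
  rewrite !primitive_Phi ?Phi_right//; lra.
Qed.

(* [Psi] is the 2h-periodic extension of [Phi]: modulo 2h, the composition of the
   two reflections is the rotation by - (h + c). *)
Let pr (x : R) : R := x - (Num.floor ((x + h) / (2 * h)))%:~R * (2 * h).

Let pr_range (x : R) : - h <= pr x < h.
Proof.
have h2 : 0 < 2 * h by rewrite mulr_gt0.
have /andP[] := floor_itv ((x + h) / (2 * h)); rewrite /pr; set k := Num.floor _.
rewrite ler_pdivlMr// ltr_pdivrMr// intrD1 (mulrDl _ 1) mul1r.
by move=> k1 k2; apply/andP; split; lra.
Qed.

Let pr_eq (x y : R) (n : int) : - h <= y < h -> x = y + n%:~R * (2 * h) -> pr x = y.
Proof.
move=> /andP[y1 y2] ->; have h2 : 0 < 2 * h by rewrite mulr_gt0.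
rewrite /pr (_ : Num.floor _ = n) ?addrK//.
apply: floor_def; rewrite ler_pdivlMr// ltr_pdivrMr// intrD1 (mulrDl _ 1) mul1r.
by apply/andP; split; lra.
Qed.

Let Psi (x : R) : R := Phi (pr x).

Let Psi_period (x : R) (n : int) : Psi (x + n%:~R * (2 * h)) = Psi x.
Proof.
congr Phi; apply: (@pr_eq _ _ (Num.floor ((x + h) / (2 * h)) + n) (pr_range x)).
by rewrite /pr rmorphD/=; ring.
Qed.

Let Psi_rot (x : R) : Psi (x - (h + c)) = Psi x - Phi c.
Proof.
have /andP[c1 c2] := jump_lt ha; have /andP[p1 p2] := pr_range x.
set k := Num.floor ((x + h) / (2 * h)).
have xE : x = pr x + k%:~R * (2 * h) by rewrite /pr -/k subrK.
have -> : Psi (x - (h + c)) = Phi (- tau (pr x)).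
  rewrite /tau /flip2; case: ifPn => [pc|].
  - congr Phi; apply: (@pr_eq _ _ (k - 1)); first lra.
    by rewrite [in LHS]xE rmorphB/=; ring.
  - rewrite -leNgt => cp; congr Phi; apply: (@pr_eq _ _ k); first lra.
    by rewrite [in LHS]xE; ring.
have tr : - h <= tau (pr x) <= h.
  by rewrite /tau /flip2; case: ifPn => [pc|]; [|rewrite -leNgt => pc]; lra.
have /andP[t1 t2] := tr.
by rewrite Phi_sigma// Phi_tau ?(ltW p2)// opprB.
Qed.

Let Psi_rotn (x : R) (n : nat) : Psi (x - n%:R * (h + c)) = Psi x - n%:R * Phi c.
Proof.
elim: n => [|n IH]; first by rewrite !mul0r !subr0.
have -> : x - n.+1%:R * (h + c) = x - n%:R * (h + c) - (h + c) by rewrite -natr1; ring.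
by rewrite Psi_rot IH -natr1; ring.
Qed.

Let Psi_rotz (x : R) (m : int) : Psi (x + m%:~R * (h + c)) = Psi x + m%:~R * Phi c.
Proof.
case: m => n; last first.
  by rewrite NegzE mulrNz !mulNr; exact: Psi_rotn.
have := Psi_rotn (x + n%:R * (h + c)) n; rewrite addrK => E.
by rewrite -pmulrn E subrK.
Qed.

Let Psi_sqr (x : R) : Psi x ^+ 2 <= 2 * h * B.
Proof.
have /andP[p1 p2] := pr_range x; apply: le_trans (Phi_sqr p1 (ltW p2)) _.
by rewrite ler_wpM2r//; lra.
Qed.

Let Phi_c : Phi c = 0.
Proof.
apply/eqP/negP => /negP k0; have k2 : 0 < Phi c ^+ 2 by rewrite exprn_even_gt0.
pose n := (Num.trunc (8 * h * B / Phi c ^+ 2)).+1.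
have nb : 8 * h * B < n%:R * Phi c ^+ 2.
  by rewrite -ltr_pdivrMr// /n truncnS_gt.
have := Psi_rotz 0 n%:Z; rewrite -pmulrn => E.
have := Psi_sqr (0 + n%:R * (h + c)); rewrite E; have := Psi_sqr 0.
set p := Psi 0; set k := Phi c in k2 nb *; move=> p1 p2.
have nn : n%:R * k ^+ 2 <= (n%:R * k) ^+ 2.
  rewrite exprMn ler_wpM2r ?sqr_ge0// expr2 -[leLHS]mulr1 ler_wpM2l//.
  by rewrite ler1n.
have := sqr_ge0 (2 * p + n%:R * k); nra.
Qed.

Let Psi_small (x : R) (m n : int) (q : int) :
  Psi (x + q%:~R * (m%:~R * (h + c) + n%:~R * (2 * h))) = Psi x.
Proof.
have -> : x + q%:~R * (m%:~R * (h + c) + n%:~R * (2 * h)) =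
  (x + (q * m)%:~R * (h + c)) + (q * n)%:~R * (2 * h) by rewrite !rmorphM/=; ring.
by rewrite Psi_period Psi_rotz Phi_c mulr0 addr0.
Qed.

Let Phi_small (x e : R) : - h <= x -> x < h -> 0 < e -> Phi x ^+ 2 <= e * B.
Proof.
move=> hx xh e0.
have alpha_irr := irrational_half irr.
have h2 : 0 < 2 * h by rewrite mulr_gt0.
have em : 0 < Num.min (e / (2 * h)) 1 by rewrite lt_min ltr01 divr_gt0.
have [m [n /andP[d0]]] := small_combination alpha_irr em.
rewrite lt_min ltr_pdivlMr// => /andP[de d1].
pose d := m%:~R * (h + c) + n%:~R * (2 * h).
have dE : d = (m%:~R * ((1 + a) / 2) + n%:~R) * (2 * h) by rewrite /d; field.
have dp : 0 < d by rewrite dE mulr_gt0.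
have d2h : d < 2 * h by rewrite dE -[ltRHS]mul1r ltr_pM2r.
pose q := Num.floor ((x + h) / d).
have /andP[q1 q2] := floor_itv ((x + h) / d).
rewrite -/q ler_pdivlMr// in q1; rewrite -/q ltr_pdivrMr// intrD1 (mulrDl _ 1) mul1r in q2.
pose r := x + h - q%:~R * d.
have r0 : 0 <= r by rewrite /r; lra.
have rd : r < d by rewrite /r; lra.
have Px : Psi x = Phi x by rewrite /Psi (@pr_eq x x 0) ?mul0r ?addr0 ?hx.
have Pr : Psi (- h + r) = Phi (- h + r).
  by rewrite /Psi (@pr_eq (- h + r) (- h + r) 0) ?mul0r ?addr0//; lra.
have := Psi_small (- h + r) m n q; rewrite -/d Pr (_ : - h + r + q%:~R * d = x);
  last by rewrite /r; ring.
rewrite Px => ->; apply: le_trans (Phi_sqr _ _) _; [lra|lra|].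
have dde : d < e by rewrite dE.
by rewrite ler_wpM2r//; lra.
Qed.

Let Phi0 (x : R) : - h <= x -> x < h -> Phi x = 0.
Proof.
move=> hx xh; apply/eqP/negP => /negP p0; have p2 : 0 < Phi x ^+ 2 by rewrite exprn_even_gt0.
have B1 : 0 < B + 1 by rewrite ltr_wpDl.
have e0 : 0 < Phi x ^+ 2 / (B + 1) by rewrite divr_gt0.
have := Phi_small hx xh e0.
have -> : Phi x ^+ 2 / (B + 1) * B = Phi x ^+ 2 - Phi x ^+ 2 / (B + 1).
  by field; rewrite gt_eqF.
by rewrite leNgt gtrBl e0.
Qed.

Lemma rotation_invariant_ae_eq0 : ae_eq mu Om f (fun=> 0).
Proof.
apply: (ae_eq0_interval (c := 0) (sqint_integrable_Omega sf)) => s t hs st th _.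
have : primitive f s t = 0 by rewrite primitive_Phi ?Phi0 ?subrr//; lra.
by [].
Qed.

End Invariant.

Lemma ip_phi0r_cst : ip mu Om (phi0r a) (fun=> 1) = (a ^+ 2 - 1) * h ^+ 2.
Proof.
have du (x : R) : is_derive x 1 (fun y : R => 2^-1 * (y * y)) x.
  have := is_derive_mul (is_derive_const 2^-1 x) (is_derive_mul (is_derive_var x)
    (is_derive_var x)).
  by move/is_derive_eq; apply; field.
have cu : continuous (fun y : R => 2^-1 * (y * y)).
  by move=> x; exact: is_derive_continuous (du x).
rewrite (ip_phi0r_three_point ha (continuous_subspaceT cu)).
- by field.
- apply: (@sqint_bounded _ _ _ _ _ (@measurable_OmegaR R) _ 1 (@Omega_fin R)) => // x _.
  by rewrite normr1.
- by apply: (weak_second_derivative_C2 du (@is_derive_var R)) => x; exact: cvg_cst.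
Qed.

Lemma metric_op_injective (f : R -> R) : sqint mu Om f ->
  ae_eq mu Om (metric_op mu Om (phi0r a) sigma tau f) (fun=> 0) -> ae_eq mu Om f (fun=> 0).
Proof.
move=> sf Tf0; have mO := @measurable_OmegaR R; have h0 := @pihalf_gt0 R.
have [pf fs ft] := metric_op_eq0 mO (sqint_phi0r ha) (@sigma_involution R) (tau_involution
  ha) sf Tf0.
pose M := (\int[mu]_(x in Om) f x) / (2 * h).
have s1 : sqint mu Om (fun=> 1 : R).
  apply: (@sqint_bounded _ _ _ _ _ mO _ 1 (@Omega_fin R)) => // x _.
  by rewrite normr1.
have sM := sqintZ mO M s1.
have sfM := sqintB mO sf sM.
have muO : fine (mu Om) = 2 * h.
  rewrite /Omega lebesgue_measure_itv/= lte_fin ifT; last lra.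
  by rewrite -EFinB/=; ring.
have fM0 : ae_eq mu Om (fun x => f x - M * 1) (fun=> 0).
  apply: rotation_invariant_ae_eq0 => //.
  - by apply: filterS fs => x fx Ox; rewrite -[RHS](fx Ox) /antisym; congr (_ / _); ring.
  - by apply: filterS ft => x fx Ox; rewrite -[RHS](fx Ox) /antisym; congr (_ / _); ring.
  - rewrite (RintegralB mO (sqint_integrable_Omega sf) (sqint_integrable_Omega sM)).
    rewrite (Rintegral_cst mu mO (M * 1)) muO mulr1 /M divfK ?subrr//.
    by rewrite mulf_neq0// gt_eqF.
have [mf _] := sf; have [mM _] := sM; have [mp _] := sqint_phi0r ha.
have fM : ae_eq mu Om f (fun x => M * 1).
  by apply: filterS fM0 => x fx Ox; apply/eqP; rewrite -subr_eq0; apply/eqP; exact: fx.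
have M0 : M = 0.
  move: pf; rewrite ipC (ae_eq_ipl mO mf mM mp fM) (ipZl mO M s1 (sqint_phi0r ha)) ipC
    ip_phi0r_cst.
  move=> /eqP; rewrite mulf_eq0 => /orP[/eqP//|]; rewrite mulf_eq0 => /orP[/eqP E|/eqP E].
  - by case/andP: ha => a1 a2; exfalso; nra.
  - by exfalso; have := exprn_gt0 2 h0; lra.
by apply: filterS fM => x fx Ox; rewrite fx// M0 mul0r.
Qed.

End Rotation.
End Injectivity.

(** * Unboundedness of the inverse *)

Section ApproximateKernel.
Context {R : realType}.
Notation mu := (@lebesgue_measure R).
Notation h := (@pi R / 2).
Notation Om := (@Omega R).
Notation mR := (measurableTypeR R).

Lemma cos_periodz (x : R) (k : int) : cos (x + k%:~R * (2 * pi)) = cos x.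
Proof.
have pos (y : R) (n : nat) : cos (y + n%:R * (2 * pi)) = cos y.
  rewrite -[RHS](periodicn (@cosD2pi R) n); congr cos; rewrite -mulr_natl -mulr_natl; ring.
case: k => n; first by rewrite -pmulrn pos.
by rewrite NegzE -(pos _ n.+1) mulrNz mulNr subrK.
Qed.

Lemma sin_periodz (x : R) (k : int) : sin (x + k%:~R * (2 * pi)) = sin x.
Proof.
have pos (y : R) (n : nat) : sin (y + n%:R * (2 * pi)) = sin y.
  rewrite -[RHS](periodicn (@sinD2pi R) n); congr sin; rewrite -mulr_natl -mulr_natl; ring.
case: k => n; first by rewrite -pmulrn pos.
by rewrite NegzE -(pos _ n.+1) mulrNz mulNr subrK.
Qed.

Section Cosine.
Context (k : int).
Let K : R := 2 * k%:~R.

(* Invariant under [sigma], and almost invariant under [tau] when k (1 + a) / 2 is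
   close to an integer. *)
Definition cosine (x : R) : R := cos (K * (x + h)).

Lemma is_derive_shift (F F' : R -> R) (L x : R) : (forall y : R, is_derive y 1 F (F' y)) ->
  is_derive x 1 (fun y => F (L * (y + h))) (L * F' (L * (x + h))).
Proof.
move=> dF; have := is_derive_affine (dF (L * x + L * h)).
by under eq_fun do rewrite -mulrDr; rewrite -mulrDr.
Qed.

Lemma cosine_derive (x : R) : is_derive x 1 cosine (- K * sin (K * (x + h))).
Proof.
have := @is_derive_shift cos (fun y => - sin y) K x (@is_derive_cos R).
by rewrite mulrN -mulNr.
Qed.

Lemma cosine_derive2 (x : R) :
  is_derive x 1 (fun y => - K * sin (K * (y + h))) (- K ^+ 2 * cosine x).
Proof.
have ds := @is_derive_shift sin cos K x (@is_derive_sin R).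
have := is_derive_mul (is_derive_const (- K) x) ds.
by move/is_derive_eq; apply; rewrite mul0r add0r /cosine; ring.
Qed.

Lemma continuous_cosine : continuous cosine.
Proof. by move=> x; exact: is_derive_continuous (cosine_derive x). Qed.

Lemma cosine_left : cosine (- h) = 1.
Proof. by rewrite /cosine addNr mulr0 cos0. Qed.

Lemma cosine_right : cosine h = 1.
Proof.
rewrite /cosine (_ : K * (h + h) = 0 + k%:~R * (2 * pi)) ?cos_periodz ?cos0//.
by rewrite /K; field.
Qed.

Lemma cosine_sigma x : cosine (sigma x) = cosine x.
Proof.
rewrite /cosine /sigma (_ : K * (- h + h - x + h) = - (K * (x + h)) + k%:~R * (2 * pi)).
  by rewrite cos_periodz cosN.
by rewrite /K; field.
Qed.

Lemma sqint_cosine : sqint mu Om cosine.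
Proof. by apply: continuous_sqint; apply: continuous_subspaceT; exact: continuous_cosine. Qed.

Lemma ip_cosine : k != 0 -> ip mu Om cosine cosine = h.
Proof.
move=> k0; have h0 := @pihalf_gt0 R.
have K0 : K != 0 by rewrite mulf_neq0// intr_eq0.
pose P (x : R) := 2^-1 * x + (4 * K)^-1 * sin (2 * K * (x + h)).
have dP (x : R) : is_derive x 1 P (cosine x * cosine x).
  have ds := @is_derive_shift sin cos (2 * K) x (@is_derive_sin R).
  have := is_derive_add (is_derive_mul (is_derive_const 2^-1 x) (is_derive_var x))
    (is_derive_mul (is_derive_const (4 * K)^-1 x) ds).
  move/is_derive_eq; apply; rewrite !mul0r !add0r mulr1.
  have -> : 2 * K * (x + h) = (K * (x + h)) *+ 2 by rewrite -mulr_natl; ring.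
  by rewrite cos_mulr2n /cosine -mulr_natl; field.
have cc : continuous (fun x => cosine x * cosine x).
  by move=> x; apply: cvgM; exact: continuous_cosine.
have hh : - h < h by lra.
rewrite /ip Rintegral_Omega_closed; last exact: continuous_subspaceT.
rewrite (Rintegral_FTC hh dP cc) /P addNr mulr0 sin0.
rewrite (_ : 2 * K * (h + h) = 0 + (2 * k)%:~R * (2 * pi)).
  by rewrite sin_periodz sin0; field.
by rewrite rmorphM/= /K; field.
Qed.

Lemma ip_phi0r_cosine (a : R) : -1 < a < 1 ->
  - K ^+ 2 * ip mu Om (phi0r a) cosine = 2 * (cosine (h * a) - 1).
Proof.
move=> ha; have mO := @measurable_OmegaR R.
have cc := continuous_cosine.
have cu'' : continuous (fun x => - K ^+ 2 * cosine x).
  by move=> x; apply: cvgM; [exact: cvg_cst|exact: cc].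
have := ip_phi0r_three_point ha (continuous_subspaceT cc) (sqintZ mO _ sqint_cosine)
  (weak_second_derivative_C2 cosine_derive cosine_derive2 cu'').
rewrite ipC (ipZl mO _ sqint_cosine (sqint_phi0r ha)) ipC cosine_left cosine_right => ->.
ring.
Qed.

Lemma cosine_tau (a d : R) (n : int) x : k%:~R * ((1 + a) / 2) + n%:~R = d ->
  cosine (tau a x) = cos (2 * pi * d) * cosine x + sin (2 * pi * d) * sin (K * (x + h)).
Proof.
move=> dE; rewrite -cosB -dE /cosine /tau /flip2; case: ifP => _.
- by rewrite -[LHS](cos_periodz _ n); congr cos; rewrite /K; field.
- by rewrite -[LHS](cos_periodz _ (n - k)); congr cos; rewrite rmorphB/= /K; field.
Qed.

Lemma cosine_jump (a d : R) (n : int) : k%:~R * ((1 + a) / 2) + n%:~R = d ->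
  cosine (h * a) = cos (2 * pi * d).
Proof.
by move=> <-; rewrite /cosine -[LHS](cos_periodz _ n); congr cos; rewrite /K; field.
Qed.

End Cosine.

Lemma approximate_kernel (a e : R) : -1 < a < 1 -> irrational a -> 0 < e ->
  exists f : R -> R, [/\ sqint mu Om f, ip mu Om f f = h &
    ip mu Om (metric_op mu Om (phi0r a) (@sigma R) (tau a) f)
      (metric_op mu Om (phi0r a) (@sigma R) (tau a) f) < e].
Proof.
move=> ha irr e0; have h0 := @pihalf_gt0 R; have mO := @measurable_OmegaR R.
have alpha_irr := irrational_half irr.
pose Bp := ip mu Om (phi0r a) (phi0r a).
have Bp0 : 0 <= Bp by exact: ip_ge0.
pose C := 3 * (4 * Bp + 2 * h).
have C0 : 0 < C by rewrite /C; lra.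
pose eta := Num.min 1 (e / (2 * C)).
have eta0 : 0 < eta by rewrite lt_min ltr01 divr_gt0//; lra.
have eta1 : eta <= 1 by rewrite ge_min lexx.
have etaC : C * eta < e.
  have : eta <= e / (2 * C) by rewrite ge_min lexx orbT.
  rewrite ler_pdivlMr; last lra.
  by move=> H; nra.
have [d0 dpos Hd] : exists2 d0 : R, 0 < d0 & forall d, 0 < d < d0 ->
    `|cos (2 * pi * d) - 1| <= eta /\ `|sin (2 * pi * d)| <= eta.
  have cc : cos (2 * pi * d) @[d --> (0 : R)] --> (1 : R).
    rewrite -[X in _ --> X](@cos0 R) -[X in cos X](mulr0 (2 * pi)).
    apply: (@continuous_comp _ _ _ (fun d => 2 * pi * d) cos); last exact: continuous_cos.
    by apply: cvgM; [exact: cvg_cst|exact: cvg_id].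
  have cs : sin (2 * pi * d) @[d --> (0 : R)] --> (0 : R).
    rewrite -[X in _ --> X](@sin0 R) -[X in sin X](mulr0 (2 * pi)).
    apply: (@continuous_comp _ _ _ (fun d => 2 * pi * d) sin); last exact: continuous_sin.
    by apply: cvgM; [exact: cvg_cst|exact: cvg_id].
  move/cvgrPdist_le/(_ _ eta0)/nbhs_ballP : cc => [d1 /= d10 H1].
  move/cvgrPdist_le/(_ _ eta0)/nbhs_ballP : cs => [d2 /= d20 H2].
  exists (Num.min d1 d2); first by rewrite lt_min d10.
  move=> d /andP[dp]; rewrite lt_min => /andP[dd1 dd2]; split.
  - by rewrite distrC; apply: H1; rewrite /ball/= sub0r normrN gtr0_norm.
  - by rewrite -[X in `|X|]subr0 distrC; apply: H2; rewrite /ball/= sub0r normrN gtr0_norm.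
have m0 : 0 < Num.min d0 1 by rewrite lt_min dpos ltr01.
have [k [n /andP[dp]]] := small_combination alpha_irr m0.
rewrite lt_min => /andP[dd0 dd1].
set d := _ + _ in dp dd0 dd1.
have [Hc Hs] : `|cos (2 * pi * d) - 1| <= eta /\ `|sin (2 * pi * d)| <= eta.
  by apply: Hd; rewrite dp.
have k0 : k != 0.
  apply/negP => /eqP k0; move: dp dd1; rewrite /d k0 mul0r add0r ltr0z => n0.
  by rewrite -[X in _ < X]/(1%:~R) ltr_int ltNge -gtz0_ge1 n0.
have sc := sqint_cosine k; exists (cosine k); split=> //; first exact: ip_cosine.
apply: le_lt_trans (metric_op_norm_le_parts mO (sqint_phi0r ha) (@sigma_involution R)
  (tau_involution ha) sc) _.
set K : R := 2 * k%:~R.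
have K1 : 1 <= K ^+ 2.
  have k1 : (1 : R) <= `|k%:~R|.
    by rewrite -intr_norm -[leLHS]/(1%:~R) ler_int -gtz0_ge1 normr_gt0.
  rewrite -real_normK ?num_real// /K normrM normr_nat; nra.
have pc : ip mu Om (phi0r a) (cosine k) ^+ 2 <= eta ^+ 2 * 4.
  have E := ip_phi0r_cosine k ha; rewrite -/K (cosine_jump (erefl d)) in E.
  have N : `|ip mu Om (phi0r a) (cosine k)| <= 2 * eta.
    have := congr1 Num.norm E; rewrite !normrM normrN normrX real_normK ?num_real//.
    rewrite normr_nat; set p := `|ip _ _ _ _| => E2.
    have : p <= K ^+ 2 * p by rewrite ler_peMl// /p normr_ge0.
    by rewrite E2; lra.
  rewrite -real_normK ?num_real// (_ : eta ^+ 2 * 4 = (2 * eta) ^+ 2); last ring.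
  by rewrite lerXn2r ?nnegrE//; lra.
have as0 : ip mu Om (antisym (@sigma R) (cosine k)) (antisym (@sigma R) (cosine k)) = 0.
  apply: (Rintegral_zero mO) => x _.
  by rewrite /antisym cosine_sigma subrr mul0r mulr0.
have at0 : ip mu Om (antisym (tau a) (cosine k)) (antisym (tau a) (cosine k)) <= eta ^+ 2 *
  (2 * h).
  have sa := sqint_antisym mO (tau_involution ha) sc.
  have muO : fine (mu Om) = 2 * h.
    rewrite /Omega lebesgue_measure_itv/= lte_fin ifT; last lra.
    by rewrite -EFinB/=; ring.
  rewrite -muO; apply: le_trans (ler_norm _) _.
  apply: (normr_Rintegral_le mO (@Omega_fin R) (sqint_mul mO sa sa)) => x _.
  rewrite -expr2 normrX lerXn2r ?nnegrE//; first exact: ltW.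
  rewrite /antisym (cosine_tau x (erefl d)) -/K normrM normfV normr_nat ler_pdivrMr//.
  have -> : cosine k x - (cos (2 * pi * d) * cosine k x + sin (2 * pi * d) * sin (K * (x +
    h))) =
     - ((cos (2 * pi * d) - 1) * cosine k x) - sin (2 * pi * d) * sin (K * (x + h)) by ring.
  apply: le_trans (ler_normB _ _) _; rewrite normrN !normrM.
  have := cos_max (K * (x + h)); have := sin_max (K * (x + h)); rewrite -/(cosine k x).
  move=> s1 c1; have := ler_pM (normr_ge0 _) (normr_ge0 _) Hc c1.
  by have := ler_pM (normr_ge0 _) (normr_ge0 _) Hs s1; rewrite !mulr1; lra.
rewrite as0 addr0.
apply: le_lt_trans (_ : _ <= 3 * (eta ^+ 2 * 4 * Bp + eta ^+ 2 * (2 * h))) _.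
  by rewrite ler_pM2l// lerD// ler_wpM2r.
apply: le_lt_trans etaC; rewrite /C.
have -> : 3 * (eta ^+ 2 * 4 * Bp + eta ^+ 2 * (2 * h)) = 3 * (4 * Bp + 2 * h) * eta ^+ 2
  by ring.
by rewrite ler_pM2l// expr2 ler_piMr// ltW.
Qed.

End ApproximateKernel.

(** * Complex-valued functions *)

Section Assembly.
Context {R : realType}.
Notation mu := (@lebesgue_measure R).
Notation h := (@pi R / 2).
Notation Om := (@Omega R).
Notation mR := (measurableTypeR R).
Local Notation C := R[i].
Local Notation Re := (@complex.Re R).
Local Notation Im := (@complex.Im R).

Lemma ReM (x y : C) : Re (x * y) = Re x * Re y - Im x * Im y.
Proof. by case: x; case: y. Qed.

Lemma ImM (x y : C) : Im (x * y) = Re x * Im y + Im x * Re y.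
Proof. by case: x; case: y. Qed.

Lemma ReD (x y : C) : Re (x + y) = Re x + Re y. Proof. by case: x; case: y. Qed.
Lemma ImD (x y : C) : Im (x + y) = Im x + Im y. Proof. by case: x; case: y. Qed.
Lemma ReN (x : C) : Re (- x) = - Re x. Proof. by case: x. Qed.
Lemma ImN (x : C) : Im (- x) = - Im x. Proof. by case: x. Qed.
Lemma Re_conj (x : C) : Re (conjc x) = Re x. Proof. by case: x. Qed.
Lemma Im_conj (x : C) : Im (conjc x) = - Im x. Proof. by case: x. Qed.

Lemma half_real : (2^-1 : C) = ((2^-1 : R)%:C)%C.
Proof. by rewrite fmorphV rmorph_nat. Qed.

Lemma complex_eqP (x y : C) : Re x = Re y -> Im x = Im y -> x = y.
Proof. by case: x => a b; case: y => c d /= -> ->. Qed.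

Lemma Re_half (x : C) : Re (x / 2) = Re x / 2.
Proof. by rewrite half_real ReM /= mulr0 subr0. Qed.

Lemma Im_half (x : C) : Im (x / 2) = Im x / 2.
Proof. by rewrite half_real ImM /= mulr0 add0r. Qed.

Lemma L2P (f : R -> C) : L2 f <->
  sqint mu Om (fun x => Re (f x)) /\ sqint mu Om (fun x => Im (f x)).
Proof.
have mO := @measurable_OmegaR R; split.
- move=> [mr mi fin].
  have ms : measurable_fun Om (fun x => Re (f x) ^+ 2 + Im (f x) ^+ 2).
    by apply: measurable_funD; exact: measurable_funX.
  have I : mu.-integrable Om (fun x => (Re (f x) ^+ 2 + Im (f x) ^+ 2)%:E).
    apply/integrableP; split; first exact/measurable_EFinP.
    by under eq_integral do rewrite gee0_abs ?lee_fin ?addr_ge0 ?sqr_ge0//.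
  split; split=> //; apply: (le_integrable mO _ _ I).
  + by apply/measurable_EFinP; exact: measurable_funX.
  + move=> x _; rewrite /= lee_fin !ger0_norm ?addr_ge0 ?sqr_ge0//.
    by rewrite lerDl sqr_ge0.
  + by apply/measurable_EFinP; exact: measurable_funX.
  + move=> x _; rewrite /= lee_fin !ger0_norm ?addr_ge0 ?sqr_ge0//.
    by rewrite lerDr sqr_ge0.
- move=> [[mr Ir] [mi Ii]]; split=> //.
  have I : mu.-integrable Om (fun x => (Re (f x) ^+ 2 + Im (f x) ^+ 2)%:E).
    have := integrableD mO Ir Ii.
    by apply: eq_integrable => [|x _]; [exact: mO|rewrite EFinD].
  have /integrableP[_] := I.
  by under eq_integral do rewrite gee0_abs ?lee_fin ?addr_ge0 ?sqr_ge0//.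
Qed.

Lemma eqL2P (f g : R -> C) : eqL2 f g <->
  ae_eq mu Om (fun x => Re (f x)) (fun x => Re (g x)) /\
  ae_eq mu Om (fun x => Im (f x)) (fun x => Im (g x)).
Proof.
split=> [fg|[fgr fgi]].
- by split; apply: filterS fg => x fx Ox; rewrite fx.
- by apply: filterS2 fgr fgi => x fr fi Ox; apply: complex_eqP; [exact: fr|exact: fi].
Qed.

Lemma innerE (f g : R -> C) : L2 f -> L2 g -> inner f g =
  ((ip mu Om (fun x => Re (f x)) (fun x => Re (g x)) +
    ip mu Om (fun x => Im (f x)) (fun x => Im (g x))) +i*
   (ip mu Om (fun x => Re (f x)) (fun x => Im (g x)) -
    ip mu Om (fun x => Im (f x)) (fun x => Re (g x))))%C.
Proof.
move=> /L2P[fr fi] /L2P[gr gi].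
have mO := @measurable_OmegaR R; rewrite /inner /Cintegral /ip; congr (_ +i* _)%C.
- rewrite -(RintegralD mO (sqint_mul mO fr gr) (sqint_mul mO fi gi)).
  by apply: eq_Rintegral => x _; rewrite ReM Re_conj Im_conj; ring.
- rewrite -(RintegralB mO (sqint_mul mO fr gi) (sqint_mul mO fi gr)).
  by apply: eq_Rintegral => x _; rewrite ImM Re_conj Im_conj; ring.
Qed.

Lemma L2normE (f : R -> C) : L2 f -> L2norm f =
  Num.sqrt (ip mu Om (fun x => Re (f x)) (fun x => Re (f x)) +
            ip mu Om (fun x => Im (f x)) (fun x => Im (f x))).
Proof. by move=> L2f; rewrite /L2norm innerE. Qed.

Lemma L2_real (f : R -> R) : sqint mu Om f -> L2 (fun x => (f x)%:C%C).
Proof.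
move=> sf; apply/L2P; split=> //=.
by apply: (@sqint_bounded _ _ _ _ _ (@measurable_OmegaR R) _ 0 (@Omega_fin R)) => // x _;
  rewrite normr0.
Qed.

Section Theta.
Context (a : R).
Context (ha : -1 < a < 1).
Notation c := (h * a).
Notation T := (metric_op mu Om (phi0r a) (@sigma R) (tau a)).
Notation mO := (@measurable_OmegaR R).

Definition Theta_fun (f : R -> C) (x : R) : C :=
  inner (phi0 a) f * phi0 a x + P0 f x + Pminus_plus a f x.

Lemma phi0E (x : R) : phi0 a x = (phi0r a x)%:C%C. Proof. by []. Qed.

Lemma Re_inner_phi0 (f : R -> C) :
  Re (inner (phi0 a) f) = ip mu Om (phi0r a) (fun x => Re (f x)).
Proof.
by apply: eq_Rintegral => x _; rewrite ReM Re_conj Im_conj phi0E/= oppr0 mul0r subr0.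
Qed.

Lemma Im_inner_phi0 (f : R -> C) :
  Im (inner (phi0 a) f) = ip mu Om (phi0r a) (fun x => Im (f x)).
Proof.
by apply: eq_Rintegral => x _; rewrite ImM Re_conj Im_conj phi0E/= oppr0 mul0r addr0.
Qed.

Lemma Re_Theta_fun (f : R -> C) x : Re (Theta_fun f x) = T (fun x => Re (f x)) x.
Proof.
rewrite /Theta_fun !ReD /metric_op; congr (_ + _ + _).
- by rewrite ReM Re_inner_phi0 phi0E/= mulr0 subr0.
- by rewrite /P0 Re_half ReD ReN /antisym /sigma addNr sub0r.
- rewrite /Pminus_plus /antisym /tau /flip2; case: ifP => _.
  + by rewrite /Pminus Re_half ReD ReN; congr ((_ - Re (f _)) / _); ring.
  + by rewrite /Pplus Re_half ReD ReN; congr ((_ - Re (f _)) / _); ring.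
Qed.

Lemma Im_Theta_fun (f : R -> C) x : Im (Theta_fun f x) = T (fun x => Im (f x)) x.
Proof.
rewrite /Theta_fun !ImD /metric_op; congr (_ + _ + _).
- by rewrite ImM Im_inner_phi0 phi0E/= mulr0 add0r.
- by rewrite /P0 Im_half ImD ImN /antisym /sigma addNr sub0r.
- rewrite /Pminus_plus /antisym /tau /flip2; case: ifP => _.
  + by rewrite /Pminus Im_half ImD ImN; congr ((_ - Im (f _)) / _); ring.
  + by rewrite /Pplus Im_half ImD ImN; congr ((_ - Im (f _)) / _); ring.
Qed.

Lemma sqint_metric (f : R -> R) : sqint mu Om f -> sqint mu Om (T f).
Proof.
exact: (sqint_metric_op mO (sqint_phi0r ha) (@sigma_involution R) (tau_involution ha)).
Qed.

Lemma metric_op_symmetric (f g : R -> R) : sqint mu Om f -> sqint mu Om g ->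
  ip mu Om (T f) g = ip mu Om f (T g).
Proof.
exact: (metric_op_sym mO (sqint_phi0r ha) (@sigma_involution R) (tau_involution ha)).
Qed.

Lemma L2_Theta_fun (f : R -> C) : L2 f -> L2 (Theta_fun f).
Proof.
move=> /L2P[fr fi]; apply/L2P.
rewrite (_ : (fun x => Re (Theta_fun f x)) = T (fun x => Re (f x))); last first.
  by apply/funext => x; exact: Re_Theta_fun.
rewrite (_ : (fun x => Im (Theta_fun f x)) = T (fun x => Im (f x))); last first.
  by apply/funext => x; exact: Im_Theta_fun.
by split; exact: sqint_metric.
Qed.

Lemma Theta_funP (f : R -> C) : L2 f -> Theta a f (Theta_fun f).
Proof. by move=> fL; split=> //; [exact: L2_Theta_fun|exact: ae_eq_refl]. Qed.

Lemma Theta_parts (f g : R -> C) : Theta a f g ->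
  [/\ sqint mu Om (fun x => Re (f x)), sqint mu Om (fun x => Im (f x)),
      sqint mu Om (fun x => Re (g x)), sqint mu Om (fun x => Im (g x)) &
      ae_eq mu Om (fun x => Re (g x)) (T (fun x => Re (f x))) /\
      ae_eq mu Om (fun x => Im (g x)) (T (fun x => Im (f x)))].
Proof.
move=> [/L2P[fr fi] /L2P[gr gi] /eqL2P[er ei]].
split=> //; split.
- by apply: filterS er => x gx Ox; rewrite -Re_Theta_fun; exact: gx.
- by apply: filterS ei => x gx Ox; rewrite -Im_Theta_fun; exact: gx.
Qed.

Lemma ip_congrl (f f' g : R -> R) : sqint mu Om f -> sqint mu Om f' -> sqint mu Om g ->
  ae_eq mu Om f f' -> ip mu Om f g = ip mu Om f' g.
Proof. by move=> [mf _] [mf' _] [mg _]; exact: (ae_eq_ipl mO mf mf' mg). Qed.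

Lemma ip_congr (f f' g g' : R -> R) : sqint mu Om f -> sqint mu Om f' ->
  sqint mu Om g -> sqint mu Om g' -> ae_eq mu Om f f' -> ae_eq mu Om g g' ->
  ip mu Om f g = ip mu Om f' g'.
Proof.
move=> sf sf' sg sg' ff' gg'.
by rewrite (ip_congrl sf sf' sg ff') ipC (ip_congrl sg sg' sf' gg') ipC.
Qed.

Lemma Theta_positive : positive_op (Theta a).
Proof.
move=> f g Tfg; have [fr fi gr gi [er ei]] := Theta_parts Tfg.
have [fL gL _] := Tfg; rewrite innerE// lecE/=.
have sTr := sqint_metric fr; have sTi := sqint_metric fi.
have aeR u : ae_eq mu Om u (u : R -> R) by exact: ae_eq_refl.
rewrite (ip_congr fr fr gi sTi (aeR _) ei) (ip_congr fi fi gr sTr (aeR _) er).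
rewrite (ip_congr fr fr gr sTr (aeR _) er) (ip_congr fi fi gi sTi (aeR _) ei).
rewrite -metric_op_symmetric// (ipC mu Om (T _)) subrr eqxx/=.
rewrite addr_ge0// ipC;
  exact: (metric_op_ge0 mO (sqint_phi0r ha) (@sigma_involution R) (tau_involution ha)).
Qed.

Lemma Theta_bounded : bounded_op (Theta a).
Proof.
pose K := 3 * (ip mu Om (phi0r a) (phi0r a) ^+ 2 + 2).
have K0 : 0 <= K by rewrite mulr_ge0// addr_ge0// sqr_ge0.
exists (Num.sqrt K) => f g Tfg; have [fr fi gr gi [er ei]] := Theta_parts Tfg.
have [fL gL _] := Tfg; rewrite !L2normE// -sqrtrM// ler_wsqrtr//.
have sTr := sqint_metric fr; have sTi := sqint_metric fi.
rewrite (ip_congr gr sTr gr sTr er er) (ip_congr gi sTi gi sTi ei ei) mulrDr.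
apply: lerD;
  exact: (metric_op_norm_le mO (sqint_phi0r ha) (@sigma_involution R) (tau_involution ha)).
Qed.

Lemma L2_lin (k : C) (f g : R -> C) : L2 f -> L2 g -> L2 (fun x => k * f x + g x).
Proof.
move=> /L2P[fr fi] /L2P[gr gi].
apply/L2P; split.
- rewrite (_ : (fun x => _) = fun x => (Re k * Re (f x) - Im k * Im (f x)) + Re (g x)).
    by apply: (sqintD mO) => //; apply: (sqintB mO) => //; exact: (sqintZ mO).
  by apply/funext => x; rewrite ReD ReM.
- rewrite (_ : (fun x => _) = fun x => (Re k * Im (f x) + Im k * Re (f x)) + Im (g x)).
    by apply: (sqintD mO) => //; apply: (sqintD mO) => //; exact: (sqintZ mO).
  by apply/funext => x; rewrite ImD ImM.
Qed.

Lemma inner_phi0_lin (k : C) (f g : R -> C) : L2 f -> L2 g ->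
  inner (phi0 a) (fun x => k * f x + g x) = k * inner (phi0 a) f + inner (phi0 a) g.
Proof.
move=> /L2P[fr fi] /L2P[gr gi].
have sp := sqint_phi0r ha.
have sZ l u : sqint mu Om u -> sqint mu Om (fun x => l * u x : R) by exact: (sqintZ mO).
apply: complex_eqP.
- rewrite ReD ReM !Re_inner_phi0 !Im_inner_phi0.
  transitivity (ip mu Om (phi0r a) (fun x => (Re k * Re (f x) - Im k * Im (f x)) + Re (g x))).
    by apply: eq_Rintegral => x _; rewrite ReD ReM.
  rewrite ipC (ipDl mO)//; last by apply: (sqintB mO); exact: sZ.
  rewrite (ipBl mO) ?(ipZl mO)//; try exact: sZ.
  by rewrite !(ipC mu Om (phi0r a)).
- rewrite ImD ImM !Re_inner_phi0 !Im_inner_phi0.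
  transitivity (ip mu Om (phi0r a) (fun x => (Re k * Im (f x) + Im k * Re (f x)) + Im (g x))).
    by apply: eq_Rintegral => x _; rewrite ImD ImM.
  rewrite ipC (ipDl mO)//; last by apply: (sqintD mO); exact: sZ.
  rewrite (ipDl mO) ?(ipZl mO)//; try exact: sZ.
  by rewrite !(ipC mu Om (phi0r a)).
Qed.

Lemma Theta_linear : linear_op (Theta a).
Proof.
move=> k f1 f2 g1 g2 [f1L g1L e1] [f2L g2L e2]; split; [exact: L2_lin|exact: L2_lin|].
apply: filterS2 e1 e2 => x e1 e2 Ox; rewrite e1// e2// inner_phi0_lin//.
rewrite /P0 /Pminus_plus /Pminus /Pplus; case: ifP => _.
- set p := inner _ f1; set q := inner _ f2; set r := phi0 a x.
  set i2 := 2^-1; ring.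
- set p := inner _ f1; set q := inner _ f2; set r := phi0 a x.
  set i2 := 2^-1; ring.
Qed.

Lemma Theta_invertible : irrational a -> invertible_op (Theta a).
Proof.
move=> irr [f f0 Tf]; apply: f0.
have [fr fi _ _ [er ei]] := Theta_parts Tf; apply/eqL2P; split.
- apply: (metric_op_injective ha irr fr); apply: filterS er => x ex Ox.
  by rewrite -ex// mul0r.
- apply: (metric_op_injective ha irr fi); apply: filterS ei => x ex Ox.
  by rewrite -ex// mul0r.
Qed.

Lemma Theta_inverse_unbounded : irrational a -> ~ bounded_op (op_inv (Theta a)).
Proof.
move=> irr [K bK]; have h0 := @pihalf_gt0 R.
have K1 : 0 < K ^+ 2 + 1 by rewrite ltr_wpDl// sqr_ge0.
have e0 : 0 < h / (K ^+ 2 + 1) by rewrite divr_gt0.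
have [f [sf fh Tfe]] := approximate_kernel ha irr e0.
pose F x := (f x)%:C%C.
have FL : L2 F by exact: L2_real.
have := bK _ _ (Theta_funP FL); rewrite !L2normE//; last exact: L2_Theta_fun.
have s0 : sqint mu Om (fun=> 0 : R).
  by apply: (@sqint_bounded _ _ _ _ _ mO _ 0 (@Omega_fin R)) => // x _; rewrite normr0.
have ip00 : ip mu Om (fun=> 0) (fun=> 0) = 0.
  by apply: (Rintegral_zero mO) => x _; rewrite mul0r.
have -> : ip mu Om (fun x => Re (Theta_fun F x)) (fun x => Re (Theta_fun F x)) =
    ip mu Om (T f) (T f).
  by apply: eq_Rintegral => x _; rewrite Re_Theta_fun.
have -> : ip mu Om (fun x => Im (Theta_fun F x)) (fun x => Im (Theta_fun F x)) = 0.
  transitivity (ip mu Om (T (fun=> 0)) (T (fun=> 0))).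
    by apply: eq_Rintegral => x _; rewrite Im_Theta_fun.
  apply/eqP; rewrite eq_le ip_ge0 andbT.
  apply: le_trans (metric_op_norm_le mO (sqint_phi0r ha) (@sigma_involution R)
    (tau_involution ha) s0) _.
  by rewrite ip00 mulr0.
rewrite /= ip00 fh !addr0; set s := ip mu Om (T f) (T f) in Tfe *.
have sge : 0 <= s by exact: ip_ge0.
move: Tfe; rewrite ltr_pdivlMr// => Tfe bd.
have sh : 0 < Num.sqrt h by rewrite sqrtr_gt0.
have := sqr_sqrtr (ltW h0); have := sqr_sqrtr sge; have := sqrtr_ge0 s.
set p := Num.sqrt h in sh bd *; set q := Num.sqrt s in bd * => q0 qs ph.
have : p ^+ 2 <= (K * q) ^+ 2 by rewrite lerXn2r ?nnegrE// ltW// (lt_le_trans sh).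
by rewrite exprMn qs ph; nra.
Qed.

Lemma Re_mulr_real (x : C) (r : R) : Re (x * r%:C%C) = Re x * r.
Proof. by rewrite ReM /= mulr0 subr0. Qed.

Lemma Im_mulr_real (x : C) (r : R) : Im (x * r%:C%C) = Im x * r.
Proof. by rewrite ImM /= mulr0 add0r. Qed.

Lemma weak_derivative_parts (u v : R -> C) : weak_derivative u v ->
  forall phi, test_function phi ->
  \int[mu]_(x in Om) (Re (u x) * (phi^`())%classic x) = - (\int[mu]_(x in Om) (Re (v x) *
    phi x)) /\
  \int[mu]_(x in Om) (Im (u x) * (phi^`())%classic x) = - (\int[mu]_(x in Om) (Im (v x) *
    phi x)).
Proof.
move=> uv phi tphi; have := uv phi tphi; rewrite /Cintegral => E.
have Er := congr1 Re E; have Ei := congr1 Im E; split.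
- transitivity (\int[mu]_(x in Om) Re (u x * (phi^`()%classic x)%:C%C)).
    by apply: eq_Rintegral => x _; rewrite Re_mulr_real.
  apply: etrans Er _; rewrite /=; congr (- _).
  by apply: eq_Rintegral => x _; rewrite Re_mulr_real.
- transitivity (\int[mu]_(x in Om) Im (u x * (phi^`()%classic x)%:C%C)).
    by apply: eq_Rintegral => x _; rewrite Im_mulr_real.
  apply: etrans Ei _; rewrite /=; congr (- _).
  by apply: eq_Rintegral => x _; rewrite Im_mulr_real.
Qed.

(* The graph of [H] restricted to real-valued functions. *)
Definition real_Hop (psi eta : R -> R) := [/\ sqint mu Om psi, sqint mu Om eta &
  exists u w, [/\ jump_pair a u w, ae_eq mu Om psi u & ae_eq mu Om eta (fun x => - w x)]].

Lemma Hop_parts (psi eta : R -> C) : Hop a psi eta ->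
  real_Hop (fun x => Re (psi x)) (fun x => Re (eta x)) /\
  real_Hop (fun x => Im (psi x)) (fun x => Im (eta x)).
Proof.
move=> [/L2P[pr pi'] [/L2P[er ei]]].
move=> [u [w [/eqL2P[ur ui] [cr ci] [v [uL vL wL uv vw]] [bl br] /eqL2P[wr wi]]]].
have /L2P[swr swi] := wL.
have weak phi (tphi : test_function phi) :=
  (weak_derivative_parts uv (test_function_derive1 tphi),
  weak_derivative_parts vw tphi).
split; split=> //.
- exists (fun x => Re (u x)), (fun x => Re (w x)); split=> //.
  + split=> //; [|by rewrite bl|by rewrite br].
    by move=> phi tphi; have [[-> _] [-> _]] := weak phi tphi; rewrite opprK.
  + by apply: filterS wr => x ex Ox; rewrite ex// ReN.
- exists (fun x => Im (u x)), (fun x => Im (w x)); split=> //.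
  + split=> //; [|by rewrite bl|by rewrite br].
    by move=> phi tphi; have [[_ ->] [_ ->]] := weak phi tphi; rewrite opprK.
  + by apply: filterS wi => x ex Ox; rewrite ex// ImN.
Qed.

Lemma real_Hop_intertwines (psi eta f k : R -> R) : real_Hop psi eta -> real_Hop f k ->
  ip mu Om (T psi) k = ip mu Om (T eta) f.
Proof.
move=> [sp se [u [w [J pu ew]]]] [sf sk [u' [w' [J' fu kw]]]].
have su := continuous_sqint (jump_continuous J); have sw := jump_sqint J.
have su' := continuous_sqint (jump_continuous J'); have sw' := jump_sqint J'.
have aeR v : ae_eq mu Om v (v : R -> R) by exact: ae_eq_refl.
have swN := sqintN mO sw; have swN' := sqintN mO sw'.
have sTk := sqint_metric sk; have sTu := sqint_metric su; have sTu' := sqint_metric su'.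
have sTe := sqint_metric se; have sTw := sqint_metric sw.
rewrite (metric_op_symmetric sp sk) (ip_congr sp su sTk sTk pu (aeR _))
  -(metric_op_symmetric su sk).
rewrite (ip_congr sTu sTu sk swN' (aeR _) kw) ipC (ipNl mO sw' sTu) ipC.
rewrite (ip_congr sTe sTe sf su' (aeR _) fu) (metric_op_symmetric se su').
rewrite (ip_congr se swN sTu' sTu' ew (aeR _)) (ipNl mO sw sTu') -(metric_op_symmetric sw su').
by congr (- _); exact: metric_op_intertwines.
Qed.

Lemma L2_continuous (f : R -> R) : continuous f -> L2 (fun x => (f x)%:C%C).
Proof.
by move=> cf; apply: L2_real; apply: continuous_sqint; exact: continuous_subspaceT.
Qed.

Lemma weak_derivative_real (u u' : R -> R) : (forall x : R, is_derive x 1 u (u' x)) ->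
  continuous u' -> weak_derivative (fun x => (u x)%:C%C) (fun x => (u' x)%:C%C).
Proof.
move=> du cu' phi tphi; have E := integration_by_parts_test du cu' tphi.
have re (g1 g2 : R -> R) : \int[mu]_(x in Om) Re ((g1 x)%:C%C * (g2 x)%:C%C) =
    \int[mu]_(x in Om) (g1 x * g2 x).
  by apply: eq_Rintegral => x _; rewrite Re_mulr_real.
have im (g1 g2 : R -> R) : \int[mu]_(x in Om) Im ((g1 x)%:C%C * (g2 x)%:C%C) = 0.
  by apply: (Rintegral_zero mO) => x _; rewrite Im_mulr_real/= mul0r.
by rewrite /Cintegral !re !im E; apply: complex_eqP; rewrite /= ?oppr0.
Qed.

Lemma bump_Hop (s t : R) (n : nat) : - h < s -> s < t -> t < h -> t < c \/ c < s ->
  Hop a (fun x => (bump s t n x)%:C%C) (fun x => - ((bump s t n)^`()^`()%classic x)%:C%C).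
Proof.
move=> hs st th stc; have eb := elem_bump s t n.
have [e1 d1] := elem_derive1 eb; have [e2 d2] := elem_derive1 e1.
have L0 := L2_continuous (elem_continuous eb).
have L1 := L2_continuous (elem_continuous e1).
have Lw := L2_continuous (elem_continuous e2).
have Lk : L2 (fun x => - ((bump s t n)^`()^`()%classic x)%:C%C).
  have := L2_continuous (f := fun x => - (bump s t n)^`()^`()%classic x) _.
  rewrite (_ : (fun x => (- _)%:C%C) = fun x => - ((bump s t n)^`()^`()%classic x)%:C%C).
    by apply=> x; apply: cvgN; exact: (elem_continuous e2).
  by apply/funext => x; rewrite rmorphN.
split=> //; split=> //.
exists (fun x => (bump s t n x)%:C%C), (fun x => ((bump s t n)^`()^`()%classic x)%:C%C).
split.
- exact: ae_eq_refl.
- split; apply: continuous_subspaceT; first exact: elem_continuous.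
  by move=> x; exact: cvg_cst.
- exists (fun x => ((bump s t n)^`()%classic x)%:C%C).
  split; [exact: L0|exact: L1|exact: Lw| |].
  + exact: (weak_derivative_real d1 (elem_continuous e1)).
  + exact: (weak_derivative_real d2 (elem_continuous e2)).
- rewrite !bump_out//; try (right; lra); try (left; lra).
  by case: stc => ?; [right|left]; exact: ltW.
- exact: ae_eq_refl.
Qed.

Lemma adjoint_unique (g g' : R -> C) : L2 g -> L2 g' ->
  (forall f k, Hop a f k -> inner g f = inner g' f) -> eqL2 g g'.
Proof.
move=> gL gL' gg'; have /L2P[gr gi] := gL.
have /L2P[gr' gi'] := gL'.
have dens (u u' : R -> R) : sqint mu Om u -> sqint mu Om u' ->
    (forall s t n, - h < s -> s < t -> t < h -> t < c \/ c < s ->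
      ip mu Om u (bump s t n) = ip mu Om u' (bump s t n)) -> ae_eq mu Om u u'.
  move=> su su' E; have sB := sqintB mO su su'.
  have : ae_eq mu Om (fun x => u x - u' x) (fun=> 0).
    apply: (@ae_eq0_interval R _ c (sqint_integrable_Omega sB)) => s t hs st th stc.
    apply: (bump_integral0 hs st th (sqint_integrable_Omega sB)) => n.
    have sb : sqint mu Om (bump s t n).
      apply: continuous_sqint; apply: continuous_subspaceT; apply: elem_continuous.
      exact: elem_bump.
    by rewrite -/(ip mu Om (fun x => u x - u' x) (bump s t n)) (ipBl mO su su' sb) E// subrr.
  by apply: filterS => x ux Ox; apply/eqP; rewrite -subr_eq0; apply/eqP; exact: ux.
have bumpE s t n : - h < s -> s < t -> t < h -> t < c \/ c < s ->
    ip mu Om (fun x => Re (g x)) (bump s t n) = ip mu Om (fun x => Re (g' x)) (bump s t n) /\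
    ip mu Om (fun x => Im (g x)) (bump s t n) = ip mu Om (fun x => Im (g' x)) (bump s t n).
  move=> hs st th stc; have Hb := bump_Hop n hs st th stc.
  have := gg' _ _ Hb; have [bL _] := Hb; rewrite !innerE//.
  have z u : ip mu Om u (fun x => Im ((bump s t n x)%:C%C)) = 0.
    by apply: (Rintegral_zero mO) => x _; rewrite mulr0.
  rewrite !z !addr0 !sub0r => E; split; first exact: (congr1 Re E).
  by apply: oppr_inj; exact: (congr1 Im E).
apply/eqL2P; split; apply: dens => // s t n hs st th stc.
- exact: (bumpE s t n hs st th stc).1.
- exact: (bumpE s t n hs st th stc).2.
Qed.

Lemma Theta_adjoint (psi eta f k theta : R -> C) : Hop a psi eta -> Hop a f k ->
  Theta a psi theta -> inner theta k = inner (Theta_fun eta) f.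
Proof.
move=> Hp Hf Tp; have [pr pi' tr ti [er ei]] := Theta_parts Tp.
have [pL [eL _]] := Hp; have [fL [kL _]] := Hf; have [_ tL _] := Tp.
rewrite innerE// innerE//; last exact: L2_Theta_fun.
have [Hpr Hpi] := Hop_parts Hp; have [Hfr Hfi] := Hop_parts Hf.
have /L2P[kr ki] := kL.
have sTr := sqint_metric pr; have sTi := sqint_metric pi'.
have -> : (fun x => Re (Theta_fun eta x)) = T (fun x => Re (eta x)).
  by apply/funext => x; exact: Re_Theta_fun.
have -> : (fun x => Im (Theta_fun eta x)) = T (fun x => Im (eta x)).
  by apply/funext => x; exact: Im_Theta_fun.
rewrite (ip_congrl tr sTr kr er) (ip_congrl tr sTr ki er).
rewrite (ip_congrl ti sTi kr ei) (ip_congrl ti sTi ki ei).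
rewrite (real_Hop_intertwines Hpr Hfr) (real_Hop_intertwines Hpr Hfi).
by rewrite (real_Hop_intertwines Hpi Hfr) (real_Hop_intertwines Hpi Hfi).
Qed.

Lemma Theta_intertwines :
  op_eq_on (dom (Hop a)) (op_comp (adjoint (Hop a)) (Theta a)) (op_comp (Theta a) (Hop a)).
Proof.
move=> psi [eta0 Hp0] g; split.
- move=> [theta Tp [tL gL adj]]; exists eta0 => //.
  have eL : L2 eta0 by case: Hp0 => _ [].
  split=> //; apply: (adjoint_unique gL (L2_Theta_fun eL)).
  by move=> f k Hf; rewrite -(adj _ _ Hf); exact: (Theta_adjoint Hp0 Hf Tp).
- move=> [eta Hp [eL gL ge]]; have [pL _] := Hp.
  exists (Theta_fun psi); first exact: Theta_funP.
  split=> //; first exact: L2_Theta_fun.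
  move=> f k Hf; rewrite (Theta_adjoint Hp Hf (Theta_funP pL)).
  have [fL _] := Hf; have TeL := L2_Theta_fun eL; rewrite !innerE//.
  have /L2P[fr fi] := fL.
  have /L2P[gr gi] := gL.
  have /L2P[tr ti] := TeL.
  have /eqL2P[er ei] := ge.
  rewrite (ip_congrl gr tr fr er) (ip_congrl gr tr fi er).
  by rewrite (ip_congrl gi ti fr ei) (ip_congrl gi ti fi ei).
Qed.

End Theta.
End Assembly.

Theorem theorem3 (R : realType) (a : R) (ha : -1 < a < 1) (ha_irr : irrational a) :
  op_eq_on (dom (Hop a))
    (op_comp (adjoint (Hop a)) (Theta a)) (op_comp (Theta a) (Hop a)) /\
  positive_op (Theta a) /\
  (everywhere_defined (Theta a) /\ linear_op (Theta a) /\ bounded_op (Theta a)) /\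
  invertible_op (Theta a) /\
  ~ bounded_op (op_inv (Theta a)).
Proof.
split; first exact: Theta_intertwines.
split; first exact: Theta_positive.
split.
  split; last by split; [exact: Theta_linear|exact: Theta_bounded].
  by move=> f fL; exists (Theta_fun a f); exact: Theta_funP.
split; first exact: Theta_invertible.
exact: Theta_inverse_unbounded.
Qed.
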